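(* Fix $\lambda>0$ and an integer $\Delta\ge1$. Let $\mathbb{G}_n$, $n\ge1$, be a sequence of finite simple $\Delta$-regular graphs with girth $g(\mathbb{G}_n)\to\infty$, and let $Z_{\mathbb{G}_n,\lambda}$ be the partition function of the continuous hardcore model with activity $\lambda$ on $\mathbb{G}_n$. Then $$\lim_{n\to\infty}\frac{\ln Z_{\mathbb{G}_n,\lambda}}{|V(\mathbb{G}_n)|}=-\ln\int_0^1\lambda^x F_{\Delta-1,\lambda}^{\Delta}(1-x)\,dx-\frac{\Delta}{2}\ln\int_0^1\dot F_{\Delta-1,\lambda}(x)\,F_{\Delta-1,\lambda}(1-x)\,dx,$$ where $F_{\Delta-1,\lambda}$ is the limiting root-marginal distribution function defined in the context (with parameter $\Delta-1$ in place of $\Delta$).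
   Context: For a finite simple graph $\mathbb{G}=(V,E)$ let $\mathcal{P}(\mathbb{G})=\{\mathbf{x}\in\mathbb{R}^V: x_u\ge0\ \forall u,\ x_u+x_v\le1\ \forall (u,v)\in E\}$, and for $\lambda>0$ let $\nu_\lambda(B)=\int_B\lambda^x dx$ for Borel $B\subset[0,1]$. The partition function of the continuous hardcore model with activity $\lambda$ is $Z_{\mathbb{G},\lambda}=\nu_\lambda^{\otimes V}(\mathcal{P}(\mathbb{G}))=\int_{\mathcal{P}(\mathbb{G})\cap[0,1]^V}\prod_{u\in V}\lambda^{x_u}\,d\mathbf{x}$, and the model itself is the probability measure $\nu_\lambda^{\otimes V}(\cdot\cap\mathcal{P}(\mathbb{G}))/Z_{\mathbb{G},\lambda}$. The girth is the length of a shortest cycle. For integers $\Delta\ge1$, $n\ge0$, $\mathbb{T}_{n,\Delta}$ is the rooted tree of depth $n$ in which every node at distance less than $n$ from the root has exactly $\Delta$ children; its leaf set $\partial\mathbb{T}_{n,\Delta}$ is the set of nodes at distance $n$ from the root. $F_{n,\Delta,\lambda}(\cdot|\mathbf{x})$ is the cumulative distribution function of the spin at the root of $\mathbb{T}_{n,\Delta}$ under the continuous hardcore model with activity $\lambda$, conditioned on the leaf spins being $\mathbf{x}\in[0,1]^{\partial\mathbb{T}_{n,\Delta}}$. Explicitly, with $\mu=\nu_\lambda$, $z\in[0,1]$: for $n=1$ and $\bar x=\max_i x_i$, $F_1(z|\mathbf{x})=\mu[0,\min(z,1-\bar x)]/\mu[0,1-\bar x]$ if $\bar x<1$, and $F_1(z|\mathbf{x})=1$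 if $\bar x=1$; for $n\ge2$, $F_n(z|\mathbf{x})=\int_{[0,z]}\prod_{i=1}^\Delta F_{n-1}(1-t|\mathbf{x}^i)\mu(dt)\big/\int_{[0,1]}\prod_{i=1}^\Delta F_{n-1}(1-t|\mathbf{x}^i)\mu(dt)$, where $\mathbf{x}^i$ is the restriction of $\mathbf{x}$ to the leaves of the subtree rooted at the $i$-th child of the root. It is known that for all integers $\Delta\ge1$ and $\lambda>0$ there is a (necessarily unique) non-decreasing function $F_{\Delta,\lambda}$ on $[0,1]$ with $F_{\Delta,\lambda}(0)=0$, continuously differentiable on $(0,1)$ with derivative $\dot F_{\Delta,\lambda}$, such that $\lim_{n\to\infty}\sup_{\mathbf{x}}\sup_{z\in[0,1]}|F_{n,\Delta,\lambda}(z|\mathbf{x})-F_{\Delta,\lambda}(z)|=0$, the supremum being over all $\mathbf{x}\in[0,1]^{\partial\mathbb{T}_{n,\Delta}}$.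
   Formalization: The first logarithm is taken with a plus sign instead of the printed minus, since the printed formula fails (Δ=2, λ=1, long cycles: it gives ln(8/π)>0 although Z≤1, while plus gives the true ln(2/π)); the graphs are assumed nonempty. *)

(* Defs.v *)
From HB Require Import structures.
From mathcomp Require Import all_boot all_order all_algebra.
From mathcomp Require Import all_classical all_reals all_analysis measurable_realfun.

Set Implicit Arguments.
Unset Strict Implicit.
Unset Printing Implicit Defensive.

Import Order.TTheory GRing.Theory Num.Theory.
Import numFieldNormedType.Exports.

Local Open Scope classical_set_scope.
Local Open Scope ring_scope.

Section product_measure.
Local Open Scope ereal_scope.
Context {d : measure_display} {T : measurableType d} {R : realType}.

(* The n-fold product of mu, by integrating the measures of the sections over
   the first coordinate, as the binary product [mu \x nu] of the library does. *)
Fixpoint power_measure (mu : set T -> \bar R) (n : nat) :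
    set (n.-tuple T) -> \bar R :=
  if n is n'.+1 then
    fun A => \int[mu]_t
      power_measure mu [set y : n'.-tuple T | A [tuple of t :: y]]
  else fun A => \d_[tuple] A.

End product_measure.

Section continuous_hardcore.
Context {R : realType}.

Definition activity (lambda : R) : set (measurableTypeR R) -> \bar R :=
  fun B => (\int[lebesgue_measure]_(x in B `&` `[0%R, 1%R]) (lambda `^ x)%:E)%E.

Section activity_measure.
Variable lambda : R.

Let activity0 : activity lambda set0 = 0%E.
Proof. by rewrite /activity set0I integral_set0. Qed.

Let activity_ge0 B : (0 <= activity lambda B)%E.
Proof. by apply: integral_ge0 => x _; rewrite lee_fin powR_ge0. Qed.

Let mpow : measurable_fun [set: R] (fun x : R => lambda `^ x).
Proof.
rewrite /powR; case: (lambda == 0).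
  apply: (@measurableT_comp _ _ _ _ _ _ (fun b : bool => b%:R : R)) => //.
  exact: measurable_fun_eqr.
by apply: measurableT_comp => //; apply: measurable_funM.
Qed.

Let activity_sigma_additive : semi_sigma_additive (activity lambda).
Proof.
move=> /= F mF tF mUF; rewrite /activity; apply: cvg_toP.
  apply: ereal_nondecreasing_is_cvgn => m n mn.
  apply: lee_sum_nneg_natr => // k _ _.
  by apply: integral_ge0 => x _; rewrite lee_fin powR_ge0.
rewrite setI_bigcupl ge0_integral_bigcup//=.
- by move=> k; exact: measurableI.
- by apply: measurable_funTS; apply/measurable_EFinP; exact: mpow.
- by move=> x _; rewrite lee_fin powR_ge0.
- exact: trivIset_setIr.
Qed.

HB.instance Definition _ := isMeasure.Build _ _ _ (activity lambda)
  activity0 activity_ge0 activity_sigma_additive.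

End activity_measure.

(* The coordinate of a vertex u is the entry of rank [enum_rank u]. *)
Definition hardcore_polytope (V : finType) (e : rel V) :
    set (#|V|.-tuple (measurableTypeR R)) :=
  [set x | (forall u, 0 <= tnth x (enum_rank u)) /\
           (forall u v, e u v ->
              tnth x (enum_rank u) + tnth x (enum_rank v) <= 1)].

Definition partition_function (V : finType) (e : rel V) (lambda : R) : R :=
  fine (power_measure (activity lambda) (hardcore_polytope e)).

(* +oo when the graph has no cycle. *)
Definition girth (V : finType) (e : rel V) : \bar R :=
  ereal_inf [set (size c)%:R%:E |
    c in [set c : seq V | ucycle e c /\ (2 < size c)%N]].

(* The depth of the tree is n.+1. A leaf is named by the path leading to it,
   as the list of the numbers of the children taken from the root on. *)
Fixpoint root_cdf (Delta : nat) (lambda : R) (n : nat) :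
    (n.+1.-tuple 'I_Delta -> R) -> R -> R :=
  match n with
  | 0 => fun x z =>
      let xbar := \big[Num.max/0]_(i < Delta) x [tuple i] in
      if xbar < 1 then
        fine (activity lambda `[0, Num.min z (1 - xbar)]) /
        fine (activity lambda `[0, 1 - xbar])
      else 1
  | n'.+1 => fun x z =>
      let weight t := \prod_(i < Delta)
        root_cdf lambda (fun p : n'.+1.-tuple 'I_Delta => x [tuple of i :: p])
          (1 - t) in
      (\int[activity lambda]_(t in `[0, z]) weight t) /
      (\int[activity lambda]_(t in `[0, 1]) weight t)
  end.

Definition is_limit_cdf (Delta : nat) (lambda : R) (F : R -> R) : Prop :=
  [/\ {in `[0, 1] &, {homo F : x y / x <= y}},
      F 0 = 0,
      {in `]0, 1[, forall x, derivable F x 1},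
      {in `]0, 1[, continuous (derive1 F)} &
      ereal_sup [set `|root_cdf lambda xz.1 xz.2 - F xz.2|%:E | xz in
        [set xz : (n.+1.-tuple 'I_Delta -> R) * R |
          (forall l, xz.1 l \in `[0, 1]) /\ xz.2 \in `[0, 1]]]
        @[n --> \oo] --> 0%E].

(* The sign of the first logarithm is positive: [ln Z] per vertex is the vertex
   term minus Delta / 2 times the edge term. For lambda = 1 and Delta = 1 one
   has F x = x, and the value is ln (1 / 2) / 2, where 1 / 2 is the area of the
   polytope of a single edge; a negative sign would give 3 / 2 * ln 2, which
   is no limit of logarithms of volumes of subsets of [0, 1]^V. *)
Definition bethe_limit (Delta : nat) (lambda : R) (F : R -> R) : R :=
  ln (\int[lebesgue_measure]_(x in `[0, 1]) (lambda `^ x * F (1 - x) ^+ Delta))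
  - Delta%:R / 2 *
    ln (\int[lebesgue_measure]_(x in `]0, 1[) (derive1 F x * F (1 - x))).

End continuous_hardcore.

(* Main.v *)
From HB Require Import structures.
Require Import Defs.
From mathcomp Require Import all_boot all_order all_algebra.
From mathcomp Require Import all_classical all_reals all_analysis.
From mathcomp Require Import measurable_realfun ring lra.

Set Implicit Arguments.
Unset Strict Implicit.
Unset Printing Implicit Defensive.

Import Order.TTheory GRing.Theory Num.Theory.
Import numFieldNormedType.Exports.

Local Open Scope classical_set_scope.
Local Open Scope ring_scope.

(** Write mu for the activity measure on [0, 1], d for Delta - 1, Phi for
    the limit distribution function, N for the number of vertices. One step
    of the tree recursion with d branches sends G to
      [cavity] G z = int_[0, z] G (1 - t)^d mu(dt) / int_[0, 1] G (1 - t)^d mu(dt),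
    so Phi is a fixed point of it, and the law with distribution function Phi
    has density Phi (1 - t)^d / C with respect to mu, where C is the integral
    of Phi (1 - t)^d.

    The proof removes the edges of the graph one at a time. Whenever an edge is
    removed, the spin x at each of its end points receives a weight Phi (1 - x),
    which is what the missing branch would contribute in the infinite tree. When no
    edge is left, the total mass is Iv^N, with Iv the integral of
    Phi (1 - t)^Delta. Consider the step that removes an edge ab, and compare
    both sides with the measure Q in which the edge is dropped without
    compensation. Under Q the spins at a and b are nearly independent, each
    with distribution function nearly Phi, because a and b are far apart and
    both see a tree with d branches. The mass with the edge is thus about
    Q(x_a + x_b <= 1) = Ie times the mass of Q, with Ie the integral of
    Phi (1 - x) against dPhi, and the mass with the two weights is about Ie^2
    times the mass of Q ([edge_close]). Each of the N Delta / 2 steps therefore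
    multiplies the mass by about Ie, so that
      ln Z = N ln Iv - (N Delta / 2) ln Ie + N o(1)
    ([cavity_mass_close], [regular_close]); the formula of the theorem follows
    because the derivative of F is lambda^x F (1 - x)^d / C ([derive_limit]).

    What has to be shown is that the law of x_a is close to Phi whatever the
    spins outside a ball around a are, although some edges of that ball have
    been replaced by weights ([tree_between]). The comparison uses the order
    [ratio_le] on unnormalized distribution functions, for which G is below G'
    when G' / G is nonincreasing. It does not see normalizing constants, and
    [cavity] reverses it. Starting from the bounds that hold for any
    nonincreasing density, n steps of the recursion leave every marginal
    between the iterates n and n + 1 of [cavity] on the constant 1. These are
    the root distributions of complete trees with all leaves at 0, and they
    converge uniformly to Phi by hypothesis. The weights Phi that stand for
    removed branches do not disturb this, because Phi, as a fixed point, lies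
    between the same iterates ([between_fixpoint]).

    In the induction on the depth the branches at the root are not separated
    by a product formula. The mass is regarded as a function of the thresholds
    imposed on the neighbours of the root; moving one threshold at a time, the
    other ones are part of a factor that does not depend on the spins near the
    neighbour under consideration ([nbr_mass_ratio]). For this the
    neighbours have to be far apart once the root is gone, which is what the
    girth gives ([nbr_far]). *)

(** * Bounded nonnegative measurable functions *)

Section bounded_measurable.
Context {R : realType}.
Implicit Types (f g : R -> R).

(** Nonnegativity is included so that Tonelli's theorem applies as well as
    linearity. *)
Definition bmeas d (T : measurableType d) (f : T -> R) :=
  measurable_fun setT f /\ exists c, forall x, 0 <= f x <= c.

Lemma bmeas_ge0 d (T : measurableType d) (f : T -> R) x : bmeas f -> 0 <= f x.
Proof. by move=> [_ [c /(_ x)/andP[]]]. Qed.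

Lemma bmeas_cst d (T : measurableType d) (c : R) : 0 <= c -> bmeas (fun _ : T => c).
Proof. by move=> c0; split; [exact: measurable_cst|exists c => x; rewrite c0/=]. Qed.

Lemma bmeasM d (T : measurableType d) (f g : T -> R) :
  bmeas f -> bmeas g -> bmeas (fun x => f x * g x).
Proof.
move=> [mf [c fc]] [mg [c' gc]]; split; first exact: measurable_funM.
exists (c * c') => x; have /andP[f0 fl] := fc x; have /andP[g0 gl] := gc x.
by rewrite mulr_ge0//= ler_pM.
Qed.

Lemma bmeasD d (T : measurableType d) (f g : T -> R) :
  bmeas f -> bmeas g -> bmeas (fun x => f x + g x).
Proof.
move=> [mf [c fc]] [mg [c' gc]]; split; first exact: measurable_funD.
exists (c + c') => x; have /andP[f0 fl] := fc x; have /andP[g0 gl] := gc x.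
by rewrite addr_ge0//= lerD.
Qed.

Lemma bmeasX d (T : measurableType d) (f : T -> R) n : bmeas f -> bmeas (fun x => f x ^+ n).
Proof.
move=> bf; elim: n => [|n IH]; first exact: bmeas_cst.
by under eq_fun do rewrite exprS; exact: bmeasM.
Qed.

Lemma bmeas_comp d (T : measurableType d) (f : R -> R) (h : T -> R) :
  bmeas f -> measurable_fun setT h -> bmeas (fun x => f (h x)).
Proof.
move=> [mf [c fc]] mh; split; first exact: measurableT_comp.
by exists c => x; exact: fc.
Qed.

Lemma bmeas_bool d (T : measurableType d) (b : T -> bool) :
  measurable_fun setT b -> bmeas (fun x => (b x)%:R : R).
Proof.
move=> mb; split.
  exact: (@measurableT_comp _ _ _ _ _ _ (fun b : bool => b%:R : R)).
by exists 1 => x; case: (b x); rewrite /= ?lexx ?ler01.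
Qed.

Lemma measurable_one_minus : measurable_fun setT (fun x : R => 1 - x).
Proof. exact: measurable_funB. Qed.

Section integral.
Context d (T : measurableType d) (mu : {finite_measure set T -> \bar R}).

Lemma bmeas_integrable (D : set T) (f : T -> R) : measurable D -> bmeas f ->
  mu.-integrable D (EFin \o f).
Proof.
move=> mD [mf [c fc]]; apply: measurable_bounded_integrable => //.
- by rewrite ltey_eq fin_num_measure.
- exact: measurable_funTS.
exists c; split; first exact: num_real.
move=> y cy x _ /=; have /andP[f0 fl] := fc x.
by rewrite ger0_norm// (le_trans fl)// ltW.
Qed.

Lemma Rintegral_bmeas_le (D : set T) (f g : T -> R) : measurable D -> bmeas f -> bmeas g ->
  (forall x, D x -> f x <= g x) ->
  \int[mu]_(x in D) f x <= \int[mu]_(x in D) g x.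
Proof. by move=> mD bf bg; apply: le_Rintegral => //; exact: bmeas_integrable. Qed.

Lemma Rintegral_bmeasZ (D : set T) (f : T -> R) c : measurable D -> bmeas f ->
  \int[mu]_(x in D) (c * f x) = c * \int[mu]_(x in D) f x.
Proof. by move=> mD bf; apply: RintegralZl => //; exact: bmeas_integrable. Qed.

Lemma Rintegral_bmeasD (D : set T) (f g : T -> R) : measurable D -> bmeas f -> bmeas g ->
  \int[mu]_(x in D) (f x + g x) = \int[mu]_(x in D) f x + \int[mu]_(x in D) g x.
Proof. by move=> mD bf bg; apply: RintegralD => //; exact: bmeas_integrable. Qed.

(** The form in which pointwise estimates, made with the other coordinates
    frozen, are integrated over the last coordinate. *)
Lemma Rintegral_bmeas_close (D : set T) (A B phi : T -> R) e : measurable D ->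
  0 <= e -> bmeas A -> bmeas B -> bmeas phi ->
  (forall x, D x -> `|A x - phi x * B x| <= e * B x) ->
  `|\int[mu]_(x in D) A x - \int[mu]_(x in D) (phi x * B x)| <=
    e * \int[mu]_(x in D) B x.
Proof.
move=> mD e0 bA bB bp h.
have be : bmeas (fun x => e * B x) by apply: bmeasM => //; exact: bmeas_cst.
have bpB : bmeas (fun x => phi x * B x) by exact: bmeasM.
rewrite -Rintegral_bmeasZ//.
have h1 : \int[mu]_(x in D) A x <= \int[mu]_(x in D) (phi x * B x + e * B x).
  apply: Rintegral_bmeas_le => //; first exact: bmeasD.
  by move=> x Dx; move: (h _ Dx); rewrite ler_norml => /andP[_]; rewrite lerBlDl.
have h2 : \int[mu]_(x in D) (phi x * B x) <= \int[mu]_(x in D) (A x + e * B x).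
  apply: Rintegral_bmeas_le => //; first exact: bmeasD.
  by move=> x Dx; move: (h _ Dx); rewrite ler_norml => /andP[+ _]; lra.
rewrite !Rintegral_bmeasD// in h1 h2.
by rewrite ler_norml; lra.
Qed.

Lemma Rintegral_bool (D : set T) (b : T -> bool) (f : T -> R) : measurable D ->
  \int[mu]_(x in D) ((b x)%:R * f x) =
  \int[mu]_(x in D `&` [set x | b x]) f x.
Proof.
move=> mD; rewrite Rintegral_mkcondr; apply: eq_Rintegral => x _.
rewrite patchE; case: ifPn; first by rewrite inE/= => ->; rewrite mul1r.
by rewrite notin_setE/= => /negP/negbTE ->; rewrite mul0r.
Qed.

End integral.

Lemma measurable_Rintegral d1 d2 (T1 : measurableType d1) (T2 : measurableType d2)
    (mu : {finite_measure set T2 -> \bar R}) (D : set T2) (f : T1 * T2 -> R) :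
  measurable D -> bmeas f ->
  bmeas (fun x => \int[mu]_(y in D) f (x, y)).
Proof.
move=> mD bf; have [mf [c fc]] := bf.
have bfx x : bmeas (fun y => f (x, y)).
  split; first exact: measurableT_comp.
  by exists c.
split; last first.
  exists (c * fine (mu D)) => x; apply/andP; split.
    by apply: Rintegral_ge0 => y _; exact: bmeas_ge0.
  rewrite -Rintegral_cst//; apply: Rintegral_bmeas_le => //; last first.
    by move=> y _; have /andP[] := fc (x, y).
  by apply: bmeas_cst; have /andP[+ _] := fc (x, point) => /le_trans; apply;
    have /andP[] := fc (x, point).
pose g := fun z : T1 * T2 => (f z * \1_D z.2)%:E.
have mg : measurable_fun setT g.
  apply/measurable_EFinP; apply: measurable_funM => //.
  by apply: measurableT_comp => //.
have g0 z : (0 <= g z)%E.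
  by rewrite lee_fin mulr_ge0// bmeas_ge0.
have := @measurable_fun_fubini_tonelli_F _ _ T1 T2 R mu g mg g0.
rewrite /fubini_F => m.
have -> : (fun x => \int[mu]_(y in D) f (x, y)) = fine \o (fun x => \int[mu]_y g (x, y))%E.
  apply/funext => x /=; rewrite Rintegral_mkcond /Rintegral; congr fine.
  apply: eq_integral => y _; rewrite /g /= patchE indicE.
  by case: ifP => _; rewrite ?mulr1 ?mulr0.
by apply: measurableT_comp; [exact: fine_measurable|exact: m].
Qed.

Lemma Rintegral_swap d1 d2 (T1 : measurableType d1) (T2 : measurableType d2)
    (m1 : {finite_measure set T1 -> \bar R})
    (m2 : {finite_measure set T2 -> \bar R}) (D1 : set T1) (D2 : set T2)
    (f : T1 * T2 -> R) :
  measurable D1 -> measurable D2 -> bmeas f ->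
  \int[m1]_(x in D1) \int[m2]_(y in D2) f (x, y) =
  \int[m2]_(y in D2) \int[m1]_(x in D1) f (x, y).
Proof.
move=> mD1 mD2 bf; have [mf [c fc]] := bf.
pose g := fun z : T1 * T2 => (f z * \1_D1 z.1 * \1_D2 z.2)%:E.
have mg : measurable_fun setT g.
  apply/measurable_EFinP; apply: measurable_funM => //.
    by apply: measurable_funM => //; exact: measurableT_comp.
  exact: measurableT_comp.
have g0 z : (0 <= g z)%E by rewrite lee_fin !mulr_ge0// bmeas_ge0.
have bfx x : bmeas (fun y => f (x, y)).
  by split; [exact: measurableT_comp|exists c].
have bfy y : bmeas (fun x => f (x, y)).
  by split; [exact: measurableT_comp|exists c].
have := @fubini_tonelli _ _ T1 T2 R m1 m2 g mg g0.
rewrite /fubini_F /fubini_G => E.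
rewrite /Rintegral; congr fine.
transitivity (\int[m1]_x \int[m2]_y g (x, y))%E; last rewrite E.
  rewrite [LHS]integral_mkcond; apply: eq_integral => x _.
  rewrite patchE; case: ifPn => xD; last first.
    rewrite integral0_eq// => y _.
    by rewrite /g/= indicE (negbTE xD) mulr0 mul0r.
  rewrite fineK; last by apply: integrable_fin_num => //; exact: bmeas_integrable.
  rewrite integral_mkcond; apply: eq_integral => y _.
  rewrite patchE /g/= !indicE xD mulr1.
  by case: ifP => _; rewrite ?mulr1 ?mulr0.
rewrite [RHS]integral_mkcond; apply: eq_integral => y _.
rewrite patchE; case: ifPn => yD; last first.
  rewrite integral0_eq// => x _.
  by rewrite /g/= [\1_D2 _]indicE (negbTE yD) mulr0.
rewrite fineK; last by apply: integrable_fin_num => //; exact: bmeas_integrable.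
rewrite [RHS]integral_mkcond; apply: eq_integral => x _.
rewrite patchE /g/= !indicE yD mulr1.
by case: ifP => _; rewrite ?mulr1 ?mulr0.
Qed.

End bounded_measurable.

(** * Iterated integrals over spin configurations *)

Section coordinates.
Context {R : realType} {V : eqType}.
Implicit Types (f g h : (V -> R) -> R) (x : V -> R) (u v w : V) (s : seq V).

Definition upd x v (t : R) : V -> R := fun w => if w == v then t else x w.

Lemma upd_eq x v t : upd x v t v = t. Proof. by rewrite /upd eqxx. Qed.

Lemma upd_neq x v t w : w != v -> upd x v t w = x w.
Proof. by rewrite /upd => /negbTE ->. Qed.

Lemma updC x u v r t : u != v -> upd (upd x u r) v t = upd (upd x v t) u r.
Proof.
move=> uv; apply/funext => w; rewrite /upd.
have [->|//] := eqVneq w v; first by rewrite eq_sym (negbTE uv).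
Qed.

(** Measurability is tested along all families of spins that depend measurably
    on a parameter, rather than with a sigma-algebra on [V -> R]. Integrating
    out one coordinate then preserves the class at once: the new spin is added
    to the parameter. *)
Definition integrand f :=
  (exists c, forall x, 0 <= f x <= c) /\
  forall d (T : measurableType d) (g : V -> T -> R),
    (forall v, measurable_fun setT (g v)) ->
    measurable_fun setT (fun t => f (fun v => g v t)).

Lemma integrand_ge0 f x : integrand f -> 0 <= f x.
Proof. by move=> [[c /(_ x)/andP[]]]. Qed.

Lemma integrand_plot f d (T : measurableType d) (g : V -> T -> R) : integrand f ->
  (forall v, measurable_fun setT (g v)) -> bmeas (fun t => f (fun v => g v t)).
Proof. by move=> [[c fc] mf] mg; split; [exact: mf|exists c]. Qed.

Lemma integrand_cst (c : R) : 0 <= c -> integrand (fun=> c).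
Proof. by move=> c0; split; [exists c => x; rewrite c0 /=|]. Qed.

Lemma integrandM f g : integrand f -> integrand g -> integrand (fun x => f x * g x).
Proof.
move=> gf gg; split; last first.
  by move=> d T h mh; apply: measurable_funM; [apply: gf.2|apply: gg.2].
have [[c fc] _] := gf; have [[c' gc] _] := gg.
exists (c * c') => x; have /andP[f0 fl] := fc x; have /andP[g0 gl] := gc x.
by rewrite mulr_ge0//= ler_pM.
Qed.

Lemma integrand_prod (I : Type) (r : seq I) (P : pred I) (F : I -> (V -> R) -> R) :
  (forall i, integrand (F i)) -> integrand (fun x => \prod_(i <- r | P i) F i x).
Proof.
move=> gF; elim: r => [|i r IH].
  by under eq_fun do rewrite big_nil; exact: integrand_cst.
under eq_fun do rewrite big_cons.
by case: (P i) => //; exact: integrandM.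
Qed.

Lemma integrand_coord (phi : R -> R) v : bmeas phi -> integrand (fun x => phi (x v)).
Proof.
move=> [mp [c pc]]; split; first by exists c => x; exact: pc.
by move=> d T g mg; exact: measurableT_comp.
Qed.

Lemma integrand_le1 v z : integrand (fun x => (x v <= z)%R%:R).
Proof.
split; first by exists 1 => x; rewrite ler0n lern1 leq_b1.
move=> d T g mg; apply: (bmeas_bool _).1.
exact: measurable_fun_ler.
Qed.

Lemma integrand_le2 u v : integrand (fun x => (x u + x v <= 1)%R%:R).
Proof.
split; first by exists 1 => x; rewrite ler0n lern1 leq_b1.
move=> d T g mg; apply: (bmeas_bool _).1.
by apply: measurable_fun_ler => //; exact: measurable_funD.
Qed.

Lemma measurable_upd d (T : measurableType d) (g : V -> T -> R) (h : T -> R) v :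
  (forall v, measurable_fun setT (g v)) -> measurable_fun setT h ->
  forall w, measurable_fun setT (fun t => upd (fun v => g v t) v (h t) w).
Proof. by move=> mg mh w; rewrite /upd; case: eqP. Qed.

Lemma integrand_upd f x v : integrand f -> bmeas (fun t => f (upd x v t)).
Proof.
move=> gf; apply: (integrand_plot (g := fun w t => upd x v t w)) => // w.
by rewrite /upd; case: eqP => // _; exact: measurable_id.
Qed.

Definition indep f s := forall x v t, v \in s -> f (upd x v t) = f x.

Lemma indepS f s s' : {subset s <= s'} -> indep f s' -> indep f s.
Proof. by move=> ss fi x v t /ss; exact: fi. Qed.

Variable mu : {finite_measure set (measurableTypeR R) -> \bar R}.

(** The vertices outside [s] keep the spins prescribed by [x]. *)
Fixpoint iint s f x : R :=
  if s is v :: s' then \int[mu]_(t in `[0, 1]) iint s' f (upd x v t) else f x.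

(** The family tested is extended by the integration variable, so that the
    measurability of partial integrals of functions of two variables applies. *)
Lemma integrand_int f v : integrand f ->
  integrand (fun x => \int[mu]_(t in `[0, 1]) f (upd x v t)).
Proof.
move=> gf; have [[c fc] mf] := gf; split.
  exists (c * fine (mu `[0, 1]%classic)) => x; apply/andP; split.
    by apply: Rintegral_ge0 => t _; exact: integrand_ge0.
  rewrite -Rintegral_cst//; apply: Rintegral_bmeas_le => //.
  - exact: integrand_upd.
  - by apply: bmeas_cst; have /andP[] := fc x; exact: le_trans.
  - by move=> t _; have /andP[] := fc (upd x v t).
move=> d T g mg.
apply: (measurable_Rintegral (f := fun z : T * measurableTypeR R =>
   f (upd (fun v => g v z.1) v z.2)) mu _ _).1 => //.
apply: (integrand_plot (g := fun w z => upd (fun v => g v z.1) v z.2 w)) => //.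
apply: (measurable_upd (g := fun v z => g v z.1)) => //.
by move=> w; exact: measurableT_comp.
Qed.

Lemma integrand_iint s f : integrand f -> integrand (iint s f).
Proof. by move=> gf; elim: s => [//|v s IH] /=; exact: integrand_int. Qed.

Lemma iint_ge0 s f x : integrand f -> 0 <= iint s f x.
Proof. by move=> gf; apply: integrand_ge0; exact: integrand_iint. Qed.

Lemma bmeas_iint s f x v : integrand f -> bmeas (fun t => iint s f (upd x v t)).
Proof. by move=> gf; apply: integrand_upd; exact: integrand_iint. Qed.

Lemma eq_iint s f g x : f =1 g -> iint s f x = iint s g x.
Proof. by move=> /funext ->. Qed.

Lemma le_iint s f g x : integrand f -> integrand g -> (forall x, f x <= g x) ->
  iint s f x <= iint s g x.
Proof.
move=> gf gg fg; elim: s x => [//|v s IH] x /=.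
by apply: Rintegral_bmeas_le => //; exact: bmeas_iint.
Qed.

Lemma iint_indepM s c f x : integrand f -> indep c s ->
  iint s (fun x => c x * f x) x = c x * iint s f x.
Proof.
move=> gf; elim: s x => [//|v s IH] x ci /=.
rewrite -Rintegral_bmeasZ//; last exact: bmeas_iint.
apply: eq_Rintegral => t _.
rewrite IH; last by apply: indepS ci => w ws; rewrite inE ws orbT.
by rewrite ci// inE eqxx.
Qed.

(** Tonelli's theorem for the spins of two vertices. *)
Lemma iint_swap u v s f x : integrand f -> iint (u :: v :: s) f x = iint (v :: u :: s) f x.
Proof.
move=> gf; have [->//|uv] := eqVneq u v; rewrite /=.
have := Rintegral_swap mu mu (D1 := `[0, 1]) (D2 := `[0, 1])
  (f := fun z => iint s f (upd (upd x u z.1) v z.2)) => /= ->//; last first.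
  apply: (integrand_plot (g := fun w z => upd (upd x u z.1) v z.2 w)).
    exact: integrand_iint.
  move=> w; apply: (measurable_upd (g := fun w z => upd x u z.1 w)) => // {}w.
  by apply: (measurable_upd (g := fun w z => x w)).
by apply: eq_Rintegral => t _; apply: eq_Rintegral => t' _; rewrite updC.
Qed.

Lemma iint_rem u s f x : integrand f -> u \in s -> iint s f x = iint (u :: rem u s) f x.
Proof.
move=> gf; elim: s x => [//|v s IH] x; rewrite inE /=.
have [->//|vu] := eqVneq v u.
move=> /= us.
rewrite -[RHS]/(iint (u :: v :: rem u s) f x) iint_swap//=.
by apply: eq_Rintegral => t _; exact: IH.
Qed.

(** The spin of any single vertex can be integrated last. *)
Lemma iint_coord (phi : R -> R) u s f x : bmeas phi -> integrand f -> uniq s -> u \in s ->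
  iint s (fun y => phi (y u) * f y) x =
  \int[mu]_(t in `[0, 1]) (phi t * iint (rem u s) f (upd x u t)).
Proof.
move=> bp gf us su; have ur : u \notin rem u s by rewrite mem_rem_uniq// inE eqxx.
rewrite (iint_rem _ _ su)/=; last by apply: integrandM => //; exact: integrand_coord.
apply: eq_Rintegral => t _; rewrite (iint_indepM (c := fun y => phi (y u)))//.
  by rewrite upd_eq.
by move=> y v t' vr; rewrite upd_neq//; apply: contraNneq ur => {1}->.
Qed.

Lemma iint_indep_upd s f x v t : indep f [:: v] -> v \notin s ->
  iint s f (upd x v t) = iint s f x.
Proof.
move=> fi; elim: s x => [|w s IH] x; first by move=> _ /=; rewrite fi// inE.
rewrite inE negb_or => /andP[vw vs] /=.
by apply: eq_Rintegral => t' _; rewrite updC// IH.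
Qed.

Lemma eq_iint_at s f g x u : u \notin s -> (forall y, y u = x u -> f y = g y) ->
  iint s f x = iint s g x.
Proof.
move=> + h; elim: s x h => [|v s IH] x h; first by move=> _; exact: h.
rewrite inE negb_or => /andP[uv us] /=; apply: eq_Rintegral => t _; apply: IH => // y.
by rewrite upd_neq//; exact: h.
Qed.

Lemma iint_prod (phi : R -> R) s x : uniq s -> bmeas phi ->
  iint s (fun x => \prod_(v <- s) phi (x v)) x =
  (\int[mu]_(t in `[0, 1]) phi t) ^+ size s.
Proof.
move=> + bp; elim: s x => [|v s IH] x /=; first by rewrite big_nil.
case/andP=> vs us.
transitivity (\int[mu]_(t in `[0, 1])
    ((\int[mu]_(t in `[0, 1]) phi t) ^+ size s * phi t)); last first.
  by rewrite Rintegral_bmeasZ// exprS mulrC.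
apply: eq_Rintegral => t _; under eq_iint do rewrite big_cons.
rewrite (iint_indepM (c := fun x => phi (x v))).
- by rewrite upd_eq IH// mulrC.
- by apply: integrand_prod => w; exact: integrand_coord.
- move=> y w r ws; rewrite upd_neq//.
  by apply: contraNneq vs => ->.
Qed.

End coordinates.

(** * The cavity recursion on the unit interval *)

Section cavity_recursion.
Context {R : realType} (mu : {finite_measure set (measurableTypeR R) -> \bar R}).
Variable d : nat.
Implicit Types (G phi psi : R -> R).

(** The unnormalized distribution function of the law with density [phi]. *)
Definition pmass phi (z : R) : R := \int[mu]_(t in `[0, 1]) ((t <= z)%R%:R * phi t).

(** The quotient [G' / G] is nonincreasing, cleared of denominators. The
    relation is insensitive to positive factors, so that
    conditional laws can be compared through unnormalized masses. *)
Definition ratio_le G G' := forall s t, s <= t -> G s * G' t <= G t * G' s.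

Lemma bmeas_le z : bmeas (fun t : measurableTypeR R => (t <= z)%R%:R : R).
Proof. by apply: bmeas_bool; exact: measurable_fun_ler. Qed.

Lemma bmeas_leM z phi : bmeas phi -> bmeas (fun t : measurableTypeR R => (t <= z)%R%:R * phi t).
Proof. by move=> bp; apply: bmeasM => //; exact: bmeas_le. Qed.

Lemma pmass_ge0 phi z : bmeas phi -> 0 <= pmass phi z.
Proof.
move=> bp; apply: Rintegral_ge0 => t _; exact: (bmeas_ge0 t (bmeas_leM z bp)).
Qed.

Lemma pmass_nondecreasing phi : bmeas phi -> {homo pmass phi : x y / x <= y}.
Proof.
move=> bp x y xy; apply: Rintegral_bmeas_le => //; try exact: bmeas_leM.
move=> t _; rewrite ler_wpM2r ?(bmeas_ge0 t bp)// ler_nat.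
by have [tx|] := leP t x; rewrite //= (le_trans tx xy).
Qed.

Lemma pmass1E phi : pmass phi 1 = \int[mu]_(t in `[0, 1]) phi t.
Proof.
apply: eq_Rintegral => t; rewrite inE/= in_itv/= => /andP[_ ->].
by rewrite mul1r.
Qed.

Lemma pmass_ge1 phi z : 1 <= z -> pmass phi z = pmass phi 1.
Proof.
move=> z1; apply: eq_Rintegral => t; rewrite inE/= in_itv/= => /andP[_ t1].
by rewrite t1 (le_trans t1 z1).
Qed.

Lemma pmass_split phi s t : bmeas phi -> s <= t ->
  pmass phi t = pmass phi s + \int[mu]_(y in `[0, 1]) ((s < y <= t)%R%:R * phi y).
Proof.
move=> bp st; have mb : bmeas (fun y : measurableTypeR R => (s < y <= t)%R%:R : R).
  apply: bmeas_bool; apply: measurable_and; first exact: measurable_fun_ltr.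
  exact: measurable_fun_ler.
rewrite -Rintegral_bmeasD//; [|exact: bmeas_leM|exact: bmeasM].
apply: eq_Rintegral => y _; rewrite -mulrDl; congr (_ * _).
by have [ys|ys] := leP y s; rewrite /= ?(le_trans ys st)// ?addr0// add0r.
Qed.

(** Monotone likelihood ratio passes to distribution functions. After
    cancelling the product of the two masses of ]-oo, s], what remains is a
    double integral over y <= s < y', where the hypothesis compares the integrands. *)
Lemma ratio_le_pmass phi psi : bmeas phi -> bmeas psi ->
  (forall t t', 0 <= t -> t <= t' -> t' <= 1 ->
     phi t' * psi t <= phi t * psi t') ->
  ratio_le (pmass psi) (pmass phi).
Proof.
move=> bp bq h s t st; rewrite (pmass_split bp st) (pmass_split bq st).
rewrite mulrDr mulrDl lerD2l.
set I : (R -> R) -> R := fun f => \int[mu]_(y in `[0, 1]) ((s < y <= t)%R%:R * f y).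
rewrite -/(I phi) -/(I psi).
have mb : bmeas (fun y : measurableTypeR R => (s < y <= t)%R%:R : R).
  apply: bmeas_bool; apply: measurable_and; first exact: measurable_fun_ltr.
  exact: measurable_fun_ler.
have I0 f : bmeas f -> 0 <= I f.
  by move=> bf; apply: Rintegral_ge0 => y _; apply: mulr_ge0 => //; exact: bmeas_ge0.
rewrite mulrC -!Rintegral_bmeasZ//; try exact: bmeas_leM.
apply: Rintegral_bmeas_le => //.
- by apply: bmeasM; [apply: bmeas_cst; exact: I0|exact: bmeas_leM].
- by apply: bmeasM; [apply: bmeas_cst; exact: I0|exact: bmeas_leM].
move=> y; rewrite /= in_itv/= => /andP[y0 y1].
have [ys|] := leP y s; rewrite /= ?mul0r ?mulr0// !mul1r.
rewrite mulrC [leRHS]mulrC /I -!Rintegral_bmeasZ//; try exact: bmeasM.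
have bc f : bmeas f ->
    bmeas (fun x : measurableTypeR R => psi y * ((s < x <= t)%R%:R * f x)).
  by move=> bf; apply: bmeasM; [apply: bmeas_cst; exact: bmeas_ge0|exact: bmeasM].
have bc' f : bmeas f ->
    bmeas (fun x : measurableTypeR R => phi y * ((s < x <= t)%R%:R * f x)).
  by move=> bf; apply: bmeasM; [apply: bmeas_cst; exact: bmeas_ge0|exact: bmeasM].
apply: Rintegral_bmeas_le => //; [exact: bc|exact: bc'|].
move=> y'; rewrite /= in_itv/= => /andP[y'0 y'1].
have [/andP[sy' y't]|_] := boolP (s < y' <= t); rewrite /= ?mul0r ?mulr0// !mul1r.
rewrite mulrC; apply: h => //; exact: (le_trans ys (ltW sy')).
Qed.

Lemma ratio_le_pmass1 phi : bmeas phi -> ratio_le (pmass phi) (fun=> 1).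
Proof. by move=> bp s t st; rewrite !mulr1; exact: pmass_nondecreasing. Qed.

(** One step of the recursion for the root marginal of a tree with [d]
    branches: a spin [t] at the root is compatible with spins at most [1 - t]
    at its children. *)
Definition cavity G z :=
  pmass (fun t => G (1 - t) ^+ d) z / pmass (fun t => G (1 - t) ^+ d) 1.

(** Starting from the constant 1, the distribution function on [0, 1] of a
    spin equal to 0, gives from rank 1 on the root marginals of the complete
    trees with all leaves at 0. *)
Fixpoint cavity_iter n : R -> R :=
  if n is n'.+1 then cavity (cavity_iter n') else fun=> 1.

Definition cdf_like G :=
  [/\ bmeas G, {homo G : x y / x <= y}, (forall z, G z <= 1), G 1 = 1 &
      forall z, 0 < z -> 0 < G z].

Hypothesis mu_pos : forall z, 0 < z -> 0 < pmass (fun=> 1) z.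

Lemma bmeas_onem G : bmeas G -> bmeas (fun t : measurableTypeR R => G (1 - t) ^+ d).
Proof.
move=> bG; apply: bmeasX; apply: (bmeas_comp (f := G)) => //.
exact: measurable_one_minus.
Qed.

Lemma pmass_onem_gt0 G z : cdf_like G -> 0 < z -> 0 < pmass (fun t => G (1 - t) ^+ d) z.
Proof.
move=> [bG mG _ _ pG] z0.
(* For t <= 1/2 the argument 1 - t stays away from 0, where G may vanish. *)
pose y := Num.min z 2^-1.
have y0 : 0 < y by rewrite lt_min z0/= invr_gt0.
have y2 : y <= 2^-1 by rewrite ge_min lexx orbT.
have yz : y <= z by rewrite ge_min lexx.
have h : 0 < G (1 - y) ^+ d * pmass (fun=> 1) y.
  by rewrite mulr_gt0 ?exprn_gt0 ?mu_pos// pG; lra.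
apply: (lt_le_trans h); apply: (@le_trans _ _ (pmass (fun t => G (1 - t) ^+ d) y));
  last first.
  by apply: pmass_nondecreasing => //; exact: bmeas_onem.
have b1 : bmeas (fun _ : measurableTypeR R => 1 : R) by exact: bmeas_cst.
rewrite /pmass -Rintegral_bmeasZ//; last exact: bmeas_leM.
apply: Rintegral_bmeas_le => //.
- apply: bmeasM; last exact: bmeas_leM.
  by apply: bmeas_cst; rewrite exprn_ge0// bmeas_ge0.
- by apply: bmeas_leM; exact: bmeas_onem.
move=> t _; have [ty|_] := leP t y; rewrite ?mul0r ?mulr0// !mul1r !mulr1.
by rewrite lerXn2r ?nnegrE ?bmeas_ge0// mG//; lra.
Qed.

Lemma cdf_like_cavity G : cdf_like G -> cdf_like (cavity G).
Proof.
move=> pG; have [bG mG _ _ _] := pG.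
have c0 z : 0 < z -> 0 < pmass (fun t => G (1 - t) ^+ d) z by exact: pmass_onem_gt0.
have bo := bmeas_onem bG.
have hm : {homo cavity G : x y / x <= y}.
  move=> x y xy; rewrite ler_pM2r ?invr_gt0 ?c0//.
  exact: pmass_nondecreasing.
have h1 : cavity G 1 = 1 by rewrite /cavity divff// gt_eqF// c0.
have hl z : cavity G z <= 1.
  rewrite -h1; have [/hm//|/ltW z1] := leP z 1.
  by rewrite /cavity [in leLHS]pmass_ge1.
split => //.
- split; first by apply: nondecreasing_measurable => //; exact: hm.
  exists 1 => z; rewrite hl andbT divr_ge0 ?pmass_ge0//.
- by move=> z z0; rewrite divr_gt0// c0.
Qed.

Lemma cdf_like_iter n : cdf_like (cavity_iter n).
Proof.
elim: n => [|n IH]; last exact: cdf_like_cavity.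
by split=> //=; exact: bmeas_cst.
Qed.

(** A spin t at the root constrains the children through 1 - t, which turns
    the direction of the comparison around. *)
Lemma ratio_le_cavityl G phi : cdf_like G -> bmeas phi ->
  (forall t t', 0 <= t -> t <= t' -> t' <= 1 ->
     phi t' * G (1 - t) ^+ d <= phi t * G (1 - t') ^+ d) ->
  ratio_le (cavity G) (pmass phi).
Proof.
move=> pG bp h s t st; have [bG _ _ _ _] := pG.
have H := ratio_le_pmass bp (bmeas_onem bG) h st.
by rewrite /cavity mulrAC [leRHS]mulrAC ler_pM2r ?invr_gt0// pmass_onem_gt0.
Qed.

Lemma ratio_le_cavityr G phi : cdf_like G -> bmeas phi ->
  (forall t t', 0 <= t -> t <= t' -> t' <= 1 ->
     phi t * G (1 - t') ^+ d <= phi t' * G (1 - t) ^+ d) ->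
  ratio_le (pmass phi) (cavity G).
Proof.
move=> pG bp h s t st; have [bG _ _ _ _] := pG.
have h' t0 t1 : 0 <= t0 -> t0 <= t1 -> t1 <= 1 ->
    G (1 - t1) ^+ d * phi t0 <= G (1 - t0) ^+ d * phi t1.
  by move=> *; rewrite mulrC [leRHS]mulrC h.
have H := ratio_le_pmass (bmeas_onem bG) bp h' st.
by rewrite /cavity !mulrA ler_pM2r ?invr_gt0// pmass_onem_gt0.
Qed.

(** Because [cavity] reverses the order, the parity of the depth decides which
    of two consecutive iterates is the lower bound. *)
Definition lower n := if odd n then cavity_iter n else cavity_iter n.+1.
Definition upper n := if odd n then cavity_iter n.+1 else cavity_iter n.

Lemma lowerS n : lower n.+1 = cavity (upper n).
Proof. by rewrite /lower /upper /=; case: (odd n). Qed.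

Lemma upperS n : upper n.+1 = cavity (lower n).
Proof. by rewrite /lower /upper /=; case: (odd n). Qed.

Lemma cdf_like_lower n : cdf_like (lower n).
Proof. by rewrite /lower; case: ifP => _; exact: cdf_like_iter. Qed.

Lemma cdf_like_upper n : cdf_like (upper n).
Proof. by rewrite /upper; case: ifP => _; exact: cdf_like_iter. Qed.

Definition between n G := ratio_le (lower n) G /\ ratio_le G (upper n).

Lemma between_step n phi : bmeas phi ->
  (forall t t', 0 <= t -> t <= t' -> t' <= 1 ->
    phi t * lower n (1 - t') ^+ d <= phi t' * lower n (1 - t) ^+ d /\
    phi t' * upper n (1 - t) ^+ d <= phi t * upper n (1 - t') ^+ d) ->
  between n.+1 (pmass phi).
Proof.
move=> bp h; split.
- rewrite lowerS; apply: ratio_le_cavityl => //; first exact: cdf_like_upper.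
  by move=> t t' t0 tt' t1; have [] := h t t' t0 tt' t1.
- rewrite upperS; apply: ratio_le_cavityr => //; first exact: cdf_like_lower.
  by move=> t t' t0 tt' t1; have [] := h t t' t0 tt' t1.
Qed.

(** A nonincreasing density has a distribution function above that of [mu],
    which is the first iterate, and below the constant 1. *)
Lemma between0 phi : bmeas phi ->
  (forall t t', 0 <= t -> t <= t' -> t' <= 1 -> phi t' <= phi t) ->
  between 0 (pmass phi).
Proof.
move=> bp h; split; last exact: ratio_le_pmass1.
apply: ratio_le_cavityl => //; first exact: (cdf_like_iter 0).
by move=> t t' t0 tt' t1; rewrite !expr1n !mulr1 h.
Qed.

(** At the point 1, where the iterates take the value 1, the order gives bounds
    for [G] relative to its total mass [G 1]. *)
Lemma between_close n G Phi e : (forall z, 0 <= G z) -> between n G ->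
  (forall z, `|cavity_iter n z - Phi z| <= e) ->
  (forall z, `|cavity_iter n.+1 z - Phi z| <= e) ->
  forall z, z <= 1 -> `|G z - Phi z * G 1| <= e * G 1.
Proof.
move=> G0 [b1 b2] h h' z z1.
have hl y : `|lower n y - Phi y| <= e by rewrite /lower; case: ifP.
have hu y : `|upper n y - Phi y| <= e by rewrite /upper; case: ifP.
have [_ _ _ l1 _] := cdf_like_lower n; have [_ _ _ u1 _] := cdf_like_upper n.
have g1 := G0 1.
have a H : ratio_le H G -> H 1 = 1 -> (forall z, `|H z - Phi z| <= e) ->
    (Phi z - e) * G 1 <= G z.
  move=> /(_ _ _ z1) p1 H1 /(_ z); rewrite H1 mul1r in p1.
  rewrite ler_norml => /andP[l _]; apply: le_trans p1.
  by rewrite ler_wpM2r//; lra.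
have a' H : ratio_le G H -> H 1 = 1 -> (forall z, `|H z - Phi z| <= e) ->
    G z <= (Phi z + e) * G 1.
  move=> /(_ _ _ z1) p1 H1 /(_ z); rewrite H1 mulr1 in p1.
  rewrite ler_norml => /andP[_ l]; apply: (le_trans p1).
  by rewrite mulrC ler_wpM2r//; lra.
have x := a _ b1 l1 hl; have y := a' _ b2 u1 hu.
by rewrite ler_norml; lra.
Qed.

Section limit.
Variable Phi : R -> R.
Hypothesis iter_cvg : forall e, 0 < e -> exists N, forall n, (N <= n)%N ->
  forall z, `|cavity_iter n z - Phi z| <= e.

(** All iterates have a nonincreasing density, so they dominate the first one;
    this keeps the limit positive away from 0. *)
Lemma cavity_iter1_le n z : z <= 1 -> cavity_iter 1 z <= cavity_iter n.+1 z.
Proof.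
move=> z1; have [bG mG _ _ _] := cdf_like_iter n.
have h : ratio_le (cavity_iter 1) (pmass (fun t => cavity_iter n (1 - t) ^+ d)).
  apply: (between0 _ _).1; first exact: bmeas_onem.
  move=> t t' t0 tt' t'1; rewrite lerXn2r ?nnegrE ?(bmeas_ge0 _ bG)//.
  by apply: mG; lra.
have [_ _ _ K1 _] := cdf_like_iter 1.
have := h _ _ z1; rewrite K1 mul1r -ler_pdivlMr//; last by apply: pmass_onem_gt0 => //;
  exact: cdf_like_iter.
Qed.

Lemma cdf_like_limit : {homo Phi : x y / x <= y} -> cdf_like Phi.
Proof.
move=> mono.
have app e : 0 < e -> exists n, forall z, `|cavity_iter n.+1 z - Phi z| <= e.
  by move=> /iter_cvg[N h]; exists N => z; apply: h.
have up z : Phi z <= 1.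
  apply/ler_addgt0Pr => e /app[n /(_ z)].
  have [_ _ /(_ z) le1 _ _] := cdf_like_iter n.+1.
  by rewrite ler_norml => /andP[]; lra.
have lo z : 0 <= Phi z.
  apply/ler_addgt0Pr => e /app[n /(_ z)].
  have [/(bmeas_ge0 z) ge0 _ _ _ _] := cdf_like_iter n.+1.
  by rewrite ler_norml => /andP[]; lra.
have lo1 z : z <= 1 -> cavity_iter 1 z <= Phi z.
  move=> z1; apply/ler_addgt0Pr => e /app[n /(_ z)].
  have := cavity_iter1_le n z1.
  by rewrite ler_norml => ? /andP[]; lra.
have [_ _ _ K11 K1p] := cdf_like_iter 1.
split => //.
- split; first exact: nondecreasing_measurable.
  by exists 1 => x; rewrite lo up.
- by apply/eqP; rewrite eq_le up -{1}K11 lo1.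
move=> z z0; apply: (@lt_le_trans _ _ (Phi (Num.min z 1))).
  apply: (@lt_le_trans _ _ (cavity_iter 1 (Num.min z 1))).
    by rewrite K1p// lt_min z0 ltr01.
  by apply: lo1; rewrite ge_min lexx orbT.
by apply: mono; rewrite ge_min lexx.
Qed.

Lemma expr_close (a b : R) n e : 0 <= a <= 1 -> 0 <= b <= 1 -> `|a - b| <= e ->
  `|a ^+ n - b ^+ n| <= n%:R * e.
Proof.
move=> a01 b01 ab; elim: n => [|n IH]; first by rewrite !expr0 subrr normr0 mul0r.
have -> : a ^+ n.+1 - b ^+ n.+1 = a * (a ^+ n - b ^+ n) + (a - b) * b ^+ n.
  by rewrite !exprS; ring.
apply: (le_trans (ler_normD _ _)); rewrite !normrM -natr1 mulrDl mul1r.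
have /andP[a0 a1] := a01; have /andP[b0 b1] := b01.
apply: lerD.
  by apply: (le_trans _ IH); rewrite ler_piMl// ger0_norm.
apply: (le_trans _ ab); rewrite ler_piMr// ger0_norm ?exprn_ge0//.
exact: exprn_ile1.
Qed.

(** Both numerator and denominator of the recursion are continuous for uniform
    convergence. *)
Lemma cavity_limit : {homo Phi : x y / x <= y} -> cavity Phi = Phi.
Proof.
move=> mono; have pP := cdf_like_limit mono; have [bP _ P1 _ _] := pP.
apply/funext => z; rewrite /cavity.
set c := pmass _ 1; have c0 : 0 < c by exact: pmass_onem_gt0.
suff E : Phi z * c = pmass (fun t => Phi (1 - t) ^+ d) z by rewrite -E mulfK ?gt_eqF.
set M := \int[mu]_(t in `[0, 1]) (1 : R).
have M0 : 0 <= M by apply: Rintegral_ge0.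
have b1 : bmeas (fun _ : measurableTypeR R => 1 : R) by exact: bmeas_cst.
have close n e y : 0 <= e -> (forall z, `|cavity_iter n z - Phi z| <= e) ->
    `|pmass (fun t => cavity_iter n (1 - t) ^+ d) y - pmass (fun t => Phi (1 - t) ^+ d) y|
      <= (d%:R * e) * M.
  move=> e0 h; have [bK _ K1 _ _] := cdf_like_iter n.
  have -> : pmass (fun t => Phi (1 - t) ^+ d) y =
      \int[mu]_(t in `[0, 1]) ((t <= y)%R%:R * Phi (1 - t) ^+ d * 1).
    by apply: eq_Rintegral => t _; rewrite mulr1.
  apply: (@Rintegral_bmeas_close _ _ _ mu _ _ (fun=> 1)) => //.
  - by rewrite mulr_ge0.
  - by apply: bmeas_leM; exact: bmeas_onem.
  - by apply: bmeas_leM; exact: bmeas_onem.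
  move=> t _; rewrite !mulr1 -mulrBr normrM.
  apply: (@le_trans _ _ (1 * `|cavity_iter n (1 - t) ^+ d - Phi (1 - t) ^+ d|)).
    by rewrite ler_wpM2r// ger0_norm// lern1 leq_b1.
  by rewrite mul1r; apply: expr_close; rewrite ?(bmeas_ge0 _ bK) ?(bmeas_ge0 _ bP)/=.
suff h : forall e, 0 < e ->
    `|Phi z * c - pmass (fun t => Phi (1 - t) ^+ d) z| <= e * (c + 2 * d%:R * M).
  apply/eqP; rewrite -subr_eq0 -normr_le0; apply/ler_addgt0Pr => e e0.
  have k0 : 0 < c + 2 * d%:R * M by rewrite ltr_wpDr// !mulr_ge0.
  by rewrite add0r (le_trans (h (e / (c + 2 * d%:R * M)) _)) ?divr_gt0// divfK// gt_eqF.
move=> e e0; have [N h] := iter_cvg e0.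
have h1 := h N (leqnn _); have h2 := h N.+1 (leqnSn _) z.
have ce := close N e z (ltW e0) h1; have cc := close N e 1 (ltW e0) h1.
rewrite -/c in cc.
set cn := pmass _ 1 in cc; have cn0 : 0 < cn by apply: pmass_onem_gt0 => //;
  exact: cdf_like_iter.
have E : pmass (fun t => cavity_iter N (1 - t) ^+ d) z = cavity_iter N.+1 z * cn.
  by rewrite /= /cavity divfK// gt_eqF.
rewrite E in ce.
have [bK _ K1 _ _] := cdf_like_iter N.+1.
have k0 := bmeas_ge0 z bK; have k1 := K1 z.
have -> : Phi z * c - pmass (fun t => Phi (1 - t) ^+ d) z =
   (Phi z - cavity_iter N.+1 z) * c + cavity_iter N.+1 z * (c - cn) +
   (cavity_iter N.+1 z * cn - pmass (fun t => Phi (1 - t) ^+ d) z) by ring.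
apply: (le_trans (ler_normD _ _)).
have -> : e * (c + 2 * d%:R * M) = e * c + d%:R * e * M + d%:R * e * M by ring.
apply: lerD => //; apply: (le_trans (ler_normD _ _)); apply: lerD.
  by rewrite normrM (gtr0_norm c0) ler_wpM2r ?(ltW c0)// distrC.
rewrite normrM (ger0_norm k0); apply: (@le_trans _ _ (1 * `|c - cn|)).
  by rewrite ler_wpM2r.
by rewrite mul1r distrC.
Qed.

End limit.

Section fixpoint.
Variable Phi : R -> R.
Hypotheses (pPhi : cdf_like Phi) (fixPhi : cavity Phi = Phi).

Let C := pmass (fun t => Phi (1 - t) ^+ d) 1.

Let C0 : 0 < C. Proof. exact: pmass_onem_gt0. Qed.

(** [Phi] has a nonincreasing density and is reproduced by every step of the
    recursion, hence never leaves the interval between the two iterates. This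
    allows a branch of a tree to be replaced by the weight [Phi]. *)
Lemma between_fixpoint n : between n Phi.
Proof.
have [bP mP _ _ _] := pPhi; have C0' := C0.
pose rho (t : R) := C^-1 * Phi (1 - t) ^+ d.
have bo := bmeas_onem bP.
have brho : bmeas rho by apply: bmeasM => //; apply: bmeas_cst; rewrite invr_ge0 ltW.
have E : Phi = pmass rho.
  rewrite -[LHS]fixPhi; apply/funext => z; rewrite /cavity mulrC -Rintegral_bmeasZ//.
    by apply: eq_Rintegral => t _; rewrite mulrCA.
  exact: bmeas_leM.
elim: n => [|n IH]; rewrite E.
  apply: between0 => // t t' t0 tt' t1; rewrite /rho ler_pM2l ?invr_gt0//.
  by rewrite lerXn2r ?nnegrE ?(bmeas_ge0 _ bP)// mP//; lra.
have [b1 b2] := IH.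
have [bl _ _ _ _] := cdf_like_lower n; have [bu _ _ _ _] := cdf_like_upper n.
apply: between_step => // t t' t0 tt' t1; rewrite /rho -!mulrA !ler_pM2l ?invr_gt0//.
have tt : 1 - t' <= 1 - t by lra.
rewrite -!exprMn; split; apply: lerXn2r;
  rewrite ?nnegrE ?mulr_ge0 ?(bmeas_ge0 _ bP) ?(bmeas_ge0 _ bl) ?(bmeas_ge0 _ bu)//.
- by rewrite mulrC [leRHS]mulrC b1.
- exact: b2.
Qed.

Lemma bmeas_pmass phi : bmeas phi -> bmeas (pmass phi).
Proof.
move=> bp; split; first by apply: nondecreasing_measurable => //;
  exact: pmass_nondecreasing.
exists (pmass phi 1) => z; rewrite pmass_ge0//=.
have [|/ltW z1] := leP z 1; first exact: pmass_nondecreasing.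
by rewrite pmass_ge1.
Qed.

(** The integral of [Phi (1 - x)] against [dPhi], that is the probability that
    two independent spins of law [Phi] sum to at most 1. *)
Definition edge_ratio :=
  (\int[mu]_(t in `[0, 1]) (Phi (1 - t) * Phi (1 - t) ^+ d)) / C.

(** Since [Phi (1 - t)] is the probability that an independent spin y of law
    [Phi] is at most [1 - t], its mean is an average over y of values of a
    distribution function, to which the hypothesis applies uniformly. *)
Lemma expectation_close w e : bmeas w -> 0 <= e ->
  (forall z, z <= 1 -> `|pmass w z - Phi z * pmass w 1| <= e * pmass w 1) ->
  `|\int[mu]_(t in `[0, 1]) (Phi (1 - t) * w t) - edge_ratio * pmass w 1| <= e * pmass w 1.
Proof.
move=> bw e0 h; have [bP mP _ _ _] := pPhi; have C0' := C0.
have bo := bmeas_onem bP.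
have bP1 : bmeas (fun t : measurableTypeR R => Phi (1 - t)).
  by apply: (bmeas_comp (f := Phi)) => //; exact: measurable_one_minus.
have w0 := pmass_ge0 1 bw.
have bow : bmeas (fun t : measurableTypeR R => Phi (1 - t) ^+ d * pmass w 1).
  by apply: bmeasM => //; exact: bmeas_cst.
(* Expand [Phi (1 - t)] by the fixed point equation and exchange the integrals. *)
have E1 : C * \int[mu]_(t in `[0, 1]) (Phi (1 - t) * w t) =
    \int[mu]_(y in `[0, 1]) (Phi (1 - y) ^+ d * pmass w (1 - y)).
  rewrite -Rintegral_bmeasZ//; last exact: bmeasM.
  transitivity (\int[mu]_(t in `[0, 1]) \int[mu]_(y in `[0, 1])
     ((y + t <= 1)%R%:R * (Phi (1 - y) ^+ d * w t))).
    apply: eq_Rintegral => t _;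
      rewrite -{1}fixPhi /cavity -/C mulrA [C * _]mulrC divfK ?gt_eqF//.
    rewrite mulrC /pmass -Rintegral_bmeasZ//; last exact: bmeas_leM.
    by apply: eq_Rintegral => y _; rewrite lerBrDr [RHS]mulrA [RHS]mulrC.
  have bf : bmeas (fun z : measurableTypeR R * measurableTypeR R =>
      (z.2 + z.1 <= 1)%R%:R * (Phi (1 - z.2) ^+ d * w z.1)).
    apply: bmeasM.
      by apply: bmeas_bool; apply: measurable_fun_ler => //; exact: measurable_funD.
    apply: bmeasM.
      by apply: (bmeas_comp (f := fun y => Phi (1 - y) ^+ d)) => //;
        exact: measurable_snd.
    by apply: (bmeas_comp (f := w)) => //; exact: measurable_fst.
  rewrite (Rintegral_swap mu mu _ _ bf)//.
  apply: eq_Rintegral => y _; rewrite /pmass -Rintegral_bmeasZ//; last exact: bmeas_leM.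
  by apply: eq_Rintegral => t _ /=; rewrite lerBrDl mulrCA.
have := @Rintegral_bmeas_close _ _ _ mu `[0, 1]%classic
   (fun y => Phi (1 - y) ^+ d * pmass w (1 - y))
   (fun y => Phi (1 - y) ^+ d * pmass w 1) (fun y => Phi (1 - y)) e.
have -> : \int[mu]_(y in `[0, 1]) (Phi (1 - y) ^+ d * pmass w 1) = C * pmass w 1.
  rewrite [RHS]mulrC [C]pmass1E -Rintegral_bmeasZ//.
  by apply: eq_Rintegral => t _; rewrite mulrC.
have -> : \int[mu]_(y in `[0, 1]) (Phi (1 - y) * (Phi (1 - y) ^+ d * pmass w 1))
    = C * (edge_ratio * pmass w 1).
  rewrite /edge_ratio [_ / C]mulrC !mulrA divff ?gt_eqF// mul1r mulrC.
  rewrite -Rintegral_bmeasZ//; last exact: bmeasM.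
  by apply: eq_Rintegral => t _; rewrite mulrA mulrC.
rewrite -E1 => H.
rewrite -(ler_pM2l C0') -{1}(gtr0_norm C0') -normrM mulrBr [leRHS]mulrCA; apply: H => //.
  apply: bmeasM => //; apply: (bmeas_comp (f := pmass w)); first exact: bmeas_pmass.
  exact: measurable_one_minus.
move=> y; rewrite /= in_itv/= => /andP[y0 y1].
rewrite mulrCA -mulrBr normrM ger0_norm; last exact: (bmeas_ge0 y bo).
by rewrite mulrCA ler_wpM2l ?(bmeas_ge0 y bo)// h//; lra.
Qed.

End fixpoint.
End cavity_recursion.

(** * Comparison of local marginals with the cavity iterates *)

Section tree_estimate.
Context {R : realType} (mu : {finite_measure set (measurableTypeR R) -> \bar R}).
Variables (d : nat) (Phi : R -> R) (V : finType).
Hypothesis mu_pos : forall z, 0 < z -> 0 < pmass mu (fun=> 1) z.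
Hypotheses (pPhi : cdf_like Phi) (fixPhi : cavity mu d Phi = Phi).
Implicit Types (H : rel V) (k : V -> nat) (x y : V -> R) (u v w : V) (s : seq V).

Definition compatible H x := [forall v, forall w, H v w ==> (x v + x w <= 1)].

(** The exponent [k v] counts the removed edges at [v]. *)
Definition gibbs_weight H k x : R :=
  (compatible H x)%:R * \prod_v Phi (1 - x v) ^+ k v.

Lemma natr_forall (I : finType) (P : pred I) :
  [forall i, P i]%:R = \prod_(i : I) (P i)%:R :> R.
Proof.
have [/forallP h|] := boolP [forall i, P i]; first by rewrite big1// => i _; rewrite h.
by rewrite negb_forall => /existsP[i /negbTE Pi]; rewrite (bigD1 i)//= Pi mul0r.
Qed.

Lemma integrand_compatible H : integrand (fun x => (compatible H x)%:R : R).
Proof.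
rewrite (_ : (fun _ => _) = fun x : V -> R =>
    \prod_v \prod_w (H v w ==> (x v + x w <= 1)%R)%:R : R).
  apply: integrand_prod => v; apply: integrand_prod => w.
  by case: (H v w) => /=; [exact: integrand_le2|exact: integrand_cst].
by apply/funext => x; rewrite natr_forall; apply: eq_bigr => v _; rewrite natr_forall.
Qed.

Lemma integrand_weight H k : integrand (gibbs_weight H k).
Proof.
apply: integrandM; first exact: integrand_compatible.
apply: integrand_prod => v; apply: (integrand_coord (phi := fun t => Phi (1 - t) ^+ k v)).
apply: bmeasX; apply: (bmeas_comp (f := Phi)); first by have [] := pPhi.
exact: measurable_one_minus.
Qed.

Definition graph_ball n H u v :=
  exists p, [/\ path H u p, last u p = v & (size p <= n)%N].

Definition no_short_cycle n H :=
  forall c, ucycle H c -> (2 < size c)%N -> (n < size c)%N.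

(** The vertex [u] stays in the graph, without edges, so that the vertex type
    does not change during the induction. *)
Definition isolate u H : rel V := fun a b => [&& a != u, b != u & H a b].

Lemma isolate_sub u H : subrel (isolate u H) H.
Proof. by move=> a b /and3P[]. Qed.

Lemma isolate_sym u H : symmetric H -> symmetric (isolate u H).
Proof. by move=> sH a b; rewrite /isolate sH; case: (a != u); case: (b != u). Qed.

Lemma path_isolate u H v p : path (isolate u H) v p -> v != u -> u \notin v :: p.
Proof.
elim: p v => [|a p IH] v /=; first by rewrite inE eq_sym => _.
move=> /andP[/and3P[va au _] pp] vu; rewrite inE eq_sym negb_or vu/=.
exact: IH.
Qed.

Lemma graph_ball_isolate n u w v H : H u w -> w != u -> graph_ball n (isolate u H) w v ->
  graph_ball n.+1 H u v /\ v != u.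
Proof.
move=> uw wu [p [pp lp sp]]; split.
  exists (w :: p); split => //=; rewrite uw/=.
  by apply: sub_path pp; exact: isolate_sub.
apply: contraNneq (path_isolate pp wu) => <-; rewrite -lp; exact: mem_last.
Qed.

(** A short path between two neighbours of [u] that avoids [u] would close up to
    a short cycle through [u]. *)
Lemma nbr_far n u w w' H : no_short_cycle n.+2 H -> symmetric H -> w != u ->
  H u w -> H u w' -> w != w' -> ~ graph_ball n (isolate u H) w w'.
Proof.
move=> nH sH wu uw uw' ww' [p [pp lp sp]].
case/shortenP: pp lp => p' pp' up' sub lp'.
have sp' : (size p' <= size p)%N by apply: uniq_leq_size => //; case/andP: up'.
have up := path_isolate pp' wu.
have := nH (u :: w :: p'); rewrite /ucycle [cycle _ _]/= [uniq _]/= up uw.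
rewrite rcons_path (sub_path _ pp') /=; last exact: isolate_sub.
rewrite lp' sH uw' andTb => /(_ up').
have : (0 < size p')%N by case: (p') lp' => //= e; rewrite e eqxx in ww'.
move=> s0 /(_ s0); rewrite !ltnS ltnNge => /negP; apply.
exact: leq_trans sp.
Qed.

Lemma compatible_isolate H u y : symmetric H -> irreflexive H ->
  compatible H y = compatible (isolate u H) y && [forall (w | H u w), y w <= 1 - y u].
Proof.
move=> sH iH; apply/idP/andP => [c|[c1 c2]].
  split.
    apply/forallP => a; apply/forallP => b; apply/implyP => /and3P[_ _ ab].
    by move/forallP/(_ a)/forallP/(_ b)/implyP: c; apply.
  apply/forallP => w; apply/implyP => uw; rewrite lerBrDl.
  by move/forallP/(_ u)/forallP/(_ w)/implyP: c; apply.
apply/forallP => a; apply/forallP => b; apply/implyP => ab.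
have [au|au] := eqVneq a u.
  by move/forallP/(_ b)/implyP: c2; rewrite au lerBrDl -au; apply.
have [bu|bu] := eqVneq b u.
  by move/forallP/(_ a)/implyP: c2; rewrite bu lerBrDr -bu sH; apply.
move/forallP/(_ a)/forallP/(_ b)/implyP: c1; apply.
by rewrite /isolate au bu.
Qed.

Definition unfield u k : V -> nat := fun v => if v == u then 0%N else k v.

(** Once the spin at the root is known, it acts on the rest of the graph only
    through thresholds on the neighbours. *)
Lemma weight_isolate H k u y : symmetric H -> irreflexive H ->
  gibbs_weight H k y = Phi (1 - y u) ^+ k u *
    (gibbs_weight (isolate u H) (unfield u k) y * \prod_(w | H u w) (y w <= 1 - y u)%R%:R).
Proof.
move=> sH iH; rewrite /gibbs_weight (compatible_isolate u)// -mulnb natrM.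
rewrite (bigD1 u)//= [in RHS](bigD1 u)//= {1}/unfield eqxx expr0 mul1r.
have -> : \prod_(v | v != u) Phi (1 - y v) ^+ unfield u k v =
          \prod_(v | v != u) Phi (1 - y v) ^+ k v.
  by apply: eq_bigr => v /negbTE vu; rewrite /unfield vu.
have -> : [forall (w | H u w), y w <= 1 - y u]%:R =
    \prod_(w | H u w) (y w <= 1 - y u)%R%:R :> R.
  rewrite natr_forall [RHS]big_mkcond; apply: eq_bigr => w _.
  by case: (H u w).
ring.
Qed.

Lemma weight_isolate_indep H k u :
  indep (gibbs_weight (isolate u H) (unfield u k)) [:: u].
Proof.
move=> x v t; rewrite inE => /eqP ->{v}; rewrite /gibbs_weight; congr (_%:R * _).
  congr nat_of_bool; apply: eq_forallb => a; apply: eq_forallb => b.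
  rewrite /isolate; have [//|au] := eqVneq a u; have [//|bu] := eqVneq b u.
  by rewrite !upd_neq.
apply: eq_bigr => v _; rewrite /unfield; have [_|vu] := eqVneq v u;
  first by rewrite !expr0.
by rewrite upd_neq.
Qed.

Definition set_all (z : V -> R) s (a : R) : V -> R :=
  foldr (fun w y => upd y w a) z s.

Lemma set_allE z s a w : set_all z s a w = if w \in s then a else z w.
Proof.
elim: s => [//|v s IH] /=; rewrite inE /upd.
by case: eqP => //=; rewrite IH.
Qed.

(** Moving the coordinates from [a] to [b] one at a time collects one factor
    for each of them. *)
Lemma ratio_coordinatewise (g : (V -> R) -> R) (U : R -> R) a b s z : uniq s ->
  0 <= U a -> 0 <= U b -> (forall z, 0 <= g z) ->
  (forall w z, w \in s -> g (upd z w a) * U b <= g (upd z w b) * U a) ->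
  g (set_all z s a) * U b ^+ size s <= g (set_all z s b) * U a ^+ size s.
Proof.
move=> us Ua Ub; elim: s us g z => [|w s IH] /=; first by move=> _ g z _ _;
  rewrite !expr0 !mulr1.
move=> /andP[ws us] g z g0 h.
have h1 : g (upd (set_all z s a) w a) * U b <= g (upd (set_all z s a) w b) * U a.
  by apply: h; rewrite inE eqxx.
have h2 := IH us (fun y => g (upd y w b)) z (fun y => g0 _).
rewrite !exprS !mulrA; apply: (le_trans (ler_wpM2r _ h1)); first exact: exprn_ge0.
rewrite mulrAC [leRHS]mulrAC ler_wpM2r//; apply: h2 => v y vs.
have wv : v != w by apply: contraNneq ws => <-.
rewrite ![upd (upd y v _) w b]updC//; apply: h.
by rewrite inE vs orbT.
Qed.

Lemma nbr_neq H u w : irreflexive H -> H u w -> w != u.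
Proof. by move=> iH; apply: contraTneq => ->; rewrite iH. Qed.

Lemma card_isolate_nbr H u w : symmetric H -> w != u -> H u w ->
  #|[set v | H w v]%SET| = #|[set v | isolate u H w v]%SET|.+1.
Proof.
move=> sH wu uw; rewrite (cardsD1 u) inE sH uw add1n; congr _.+1.
by apply: eq_card => v; rewrite !inE /isolate wu.
Qed.

Lemma card_isolate_far H u v : symmetric H -> v != u -> ~~ H u v ->
  #|[set w | H v w]%SET| = #|[set w | isolate u H v w]%SET|.
Proof.
move=> sH vu uv; apply: eq_card => w; rewrite !inE /isolate vu /=.
by have [->|//] := eqVneq w u; rewrite sH (negbTE uv).
Qed.

(** The mass of the configurations of the graph without its root [u], in which
    the spin of each neighbour [w] is at most [z w]. *)
Definition nbr_mass H k s h x u (z : V -> R) : R :=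
  iint mu (rem u s) (fun y => gibbs_weight (isolate u H) (unfield u k) y *
    (\prod_(w | H u w) (y w <= z w)%R%:R * h y)) x.

Lemma integrand_nbr_mass H k h u (z : V -> R) : integrand h ->
  integrand (fun y => gibbs_weight (isolate u H) (unfield u k) y *
    (\prod_(w | H u w) (y w <= z w)%R%:R * h y)).
Proof.
move=> gh; apply: integrandM; first exact: integrand_weight.
by apply: integrandM => //; apply: integrand_prod => w; exact: integrand_le1.
Qed.

(** Integrating the root last exhibits its density: the weight of its removed
    edges times the mass that the thresholds [1 - t] leave to the rest. *)
Lemma peel_root H k s h x u : symmetric H -> irreflexive H -> integrand h -> uniq s ->
  u \in s -> indep h [:: u] ->
  let phi t := Phi (1 - t) ^+ k u * nbr_mass H k s h x u (fun=> 1 - t) in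
  bmeas phi /\
  (fun z => iint mu s (fun y => (y u <= z)%R%:R * (gibbs_weight H k y * h y)) x) =
    pmass mu phi.
Proof.
move=> sH iH gh us su hu phi.
have ur : u \notin rem u s by rewrite mem_rem_uniq// inE eqxx.
have gW : integrand (fun y => gibbs_weight H k y * h y) by apply: integrandM => //;
  exact: integrand_weight.
have phiE : phi = fun t =>
    iint mu (rem u s) (fun y => gibbs_weight H k y * h y) (upd x u t).
  apply/funext => t.
  rewrite (@eq_iint_at _ _ mu _ _ (fun y => Phi (1 - t) ^+ k u *
    (gibbs_weight (isolate u H) (unfield u k) y *
    (\prod_(w | H u w) (y w <= 1 - t)%R%:R * h y))) _ u)//; last first.
    by move=> y; rewrite upd_eq => yu; rewrite (weight_isolate k u y sH iH) yu -!mulrA.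
  have gn := integrand_nbr_mass H k u (fun=> 1 - t) gh.
  rewrite (iint_indepM mu (c := fun=> Phi (1 - t) ^+ k u) _ gn)//; congr (_ * _).
  rewrite iint_indep_upd// => y v r; rewrite inE => /eqP ->{v}.
  rewrite weight_isolate_indep ?inE// hu ?inE//; congr (_ * (_ * _)).
  by apply: eq_bigr => w uw; rewrite upd_neq// (nbr_neq iH).
have bphi : bmeas phi by rewrite phiE; exact: bmeas_iint.
split => //; apply/funext => z; rewrite phiE.
apply: (iint_coord mu (phi := fun t : measurableTypeR R => (t <= z)%R%:R)) => //.
exact: bmeas_le.
Qed.

Lemma nbr_mass_ge0 H k s h x u z : integrand h -> 0 <= nbr_mass H k s h x u z.
Proof. by move=> gh; apply: iint_ge0; exact: integrand_nbr_mass. Qed.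

(** As a function of one threshold, the mass is an unnormalized distribution
    function at that neighbour. The other thresholds join the factor [h]. *)
Lemma nbr_mass_upd H k s h x u z w a : H u w ->
  nbr_mass H k s h x u (upd z w a) =
  iint mu (rem u s) (fun y => (y w <= a)%R%:R *
    (gibbs_weight (isolate u H) (unfield u k) y *
      (\prod_(w' | H u w' && (w' != w)) (y w' <= z w')%R%:R * h y))) x.
Proof.
move=> uw; apply: eq_iint => y; rewrite (bigD1 w)//= upd_eq.
have -> : \prod_(w' | H u w' && (w' != w)) (y w' <= upd z w a w')%R%:R =
    \prod_(w' | H u w' && (w' != w)) (y w' <= z w')%R%:R :> R.
  by apply: eq_bigr => w' /andP[_ ww]; rewrite upd_neq.
ring.
Qed.

Lemma nbr_mass_eq H k s h x u z z' : (forall w, H u w -> z w = z' w) ->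
  nbr_mass H k s h x u z = nbr_mass H k s h x u z'.
Proof.
move=> zz; apply: eq_iint => y; congr (_ * (_ * _)).
by apply: eq_bigr => w uw; rewrite zz.
Qed.

(** The [d] factors of the recursion come from the removed edges at [u], which
    carry [Phi], and from its neighbours. *)
Lemma nbr_mass_ratio H k s h x u U a b :
  (k u + #|[set w | H u w]%SET| = d)%N -> integrand h -> (forall z, 0 <= U z) ->
  Phi a * U b <= Phi b * U a ->
  (forall w z, H u w -> nbr_mass H k s h x u (upd z w a) * U b <=
                        nbr_mass H k s h x u (upd z w b) * U a) ->
  Phi a ^+ k u * nbr_mass H k s h x u (fun=> a) * U b ^+ d <=
  Phi b ^+ k u * nbr_mass H k s h x u (fun=> b) * U a ^+ d.
Proof.
move=> <- gh U0 hP hg; have [bP _ _ _ _] := pPhi.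
pose ws := enum [set w | H u w]%SET.
have e c : nbr_mass H k s h x u (fun=> c) =
           nbr_mass H k s h x u (set_all (fun=> 0) ws c).
  by apply: nbr_mass_eq => w uw; rewrite set_allE mem_enum inE uw.
rewrite !exprD cardE -/ws mulrACA [leRHS]mulrACA -!exprMn.
apply: ler_pM.
- by rewrite exprn_ge0// mulr_ge0// (bmeas_ge0 _ bP).
- by rewrite mulr_ge0 ?exprn_ge0// nbr_mass_ge0.
- by rewrite lerXn2r// nnegrE mulr_ge0// (bmeas_ge0 _ bP).
rewrite !e; apply: ratio_coordinatewise => //; first exact: enum_uniq.
  by move=> z; exact: nbr_mass_ge0.
by move=> w z; rewrite mem_enum inE; exact: hg.
Qed.

(** The marginal at [u] is controlled whatever happens far away: [h] is an
    arbitrary weight that ignores the ball, and [x] an arbitrary configuration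
    outside [s]. In the inductive step each neighbour becomes the root of a
    smaller ball in the graph where [u] is isolated, in which it has lost
    exactly one edge. *)
Lemma tree_between n H k s h x u : symmetric H -> irreflexive H ->
  no_short_cycle n.+1 H -> integrand h -> uniq s ->
  (forall v, graph_ball n H u v -> v \in s /\ indep h [:: v]) ->
  (k u + #|[set w | H u w]%SET| = d)%N ->
  (forall v, v != u -> graph_ball n H u v -> (k v + #|[set w | H v w]%SET| = d.+1)%N) ->
  between mu d n
    (fun z => iint mu s (fun y => (y u <= z)%R%:R * (gibbs_weight H k y * h y)) x).
Proof.
have [bP mP _ _ _] := pPhi.
elim: n H k s h x u => [|n IH] H k s h x u sH iH nH gh us bs ku kv.
all: have [su hu] : u \in s /\ indep h [:: u] by apply: bs; exists [::].
all: have [bphi ->] := peel_root k x sH iH gh us su hu.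
  apply: between0 => // t t' t0 tt' t1.
  apply: ler_pM.
  - by rewrite exprn_ge0// (bmeas_ge0 _ bP).
  - exact: nbr_mass_ge0.
  - by rewrite lerXn2r ?nnegrE ?(bmeas_ge0 _ bP)// mP//; lra.
  apply: le_iint; [exact: integrand_nbr_mass|exact: integrand_nbr_mass|] => y.
  apply: ler_wpM2l; first by apply: integrand_ge0; exact: integrand_weight.
  apply: ler_wpM2r; first exact: integrand_ge0.
  apply: ler_prod => w _; rewrite ler0n ler_nat /=.
  have [yt|//] := leP (y w) (1 - t').
  by have -> : y w <= 1 - t by lra.
(* Each threshold separately: the induction hypothesis in the isolated graph. *)
have child w z : H u w ->
    between mu d n (fun a => nbr_mass H k s h x u (upd z w a)).
  move=> uw; have wu := nbr_neq iH uw.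
  under eq_fun do rewrite nbr_mass_upd//.
  apply: IH.
  - exact: isolate_sym.
  - by move=> a; rewrite /isolate iH !andbF.
  - move=> c cc c2; apply: (leq_trans _ (nH c _ c2)) => //.
    case/andP: cc => cc uc; apply/andP; split => //.
    case: c cc {c2 uc} => // a c; apply: sub_path; exact: isolate_sub.
  - apply: integrandM => //; apply: integrand_prod => w'; exact: integrand_le1.
  - exact: rem_uniq.
  - move=> v bv; have [bv' vu] := graph_ball_isolate uw wu bv.
    have [vs hv] := bs v bv'; split; first by rewrite mem_rem_uniq// inE vu.
    move=> y v' t; rewrite inE => /eqP ->{v'}; rewrite hv ?inE//; congr (_ * _).
    apply: eq_bigr => w' /andP[uw' w'w]; rewrite upd_neq//.
    apply/eqP => w'v; apply: (nbr_far nH sH wu uw uw'); first by rewrite eq_sym.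
    by rewrite w'v.
  - apply: succn_inj; rewrite /unfield (negbTE wu) -addnS -(card_isolate_nbr sH wu uw).
    by rewrite kv//; exists [:: w]; rewrite /= uw.
  move=> v vw bv; have [bv' vu] := graph_ball_isolate uw wu bv.
  rewrite /unfield (negbTE vu) -(card_isolate_far sH vu) ?kv//.
  apply/negP => uv; apply: (nbr_far nH sH wu uw uv) => //.
  by rewrite eq_sym.
have [f1 f2] := between_fixpoint mu_pos pPhi fixPhi n.
have [bl _ _ _ _] := cdf_like_lower d mu_pos n;
  have [bu _ _ _ _] := cdf_like_upper d mu_pos n.
apply: between_step => // t t' t0 tt' t1; have tt : 1 - t' <= 1 - t by lra.
split; apply: nbr_mass_ratio => //; try by move=> z; exact: bmeas_ge0.
- by rewrite mulrC [leRHS]mulrC f1.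
- by move=> w z uw; have [c1 _] := child w z uw; rewrite mulrC [leRHS]mulrC c1.
- exact: f2.
- by move=> w z uw; have [_ c2] := child w z uw; exact: c2.
Qed.

End tree_estimate.

(** * Removing the edges one at a time *)

Section edge_removal.
Context {R : realType} (mu : {finite_measure set (measurableTypeR R) -> \bar R}).
Variables (d : nat) (Phi : R -> R) (V : finType).
Hypothesis mu_pos : forall z, 0 < z -> 0 < pmass mu (fun=> 1) z.
Hypotheses (pPhi : cdf_like Phi) (fixPhi : cavity mu d Phi = Phi).
Variables (n : nat) (e : R).
Hypotheses (e0 : 0 <= e) (Kn : forall z, `|cavity_iter mu d n z - Phi z| <= e)
  (Kn1 : forall z, `|cavity_iter mu d n.+1 z - Phi z| <= e).
Implicit Types (H : rel V) (k : V -> nat) (x y : V -> R) (u v w a b : V) (s : seq V).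

Local Notation weight := (gibbs_weight Phi).
Local Notation Ie := (edge_ratio mu d Phi).

Definition degree H v := #|[set w | H v w]%SET|.

Lemma bmeas_Phi1 : bmeas (fun t : measurableTypeR R => Phi (1 - t)).
Proof.
apply: (bmeas_comp (f := Phi)); first by have [] := pPhi.
exact: measurable_one_minus.
Qed.

(** Closeness of the distribution function gives closeness of the mean of
    [Phi (1 - y u)], the weight that a removed edge puts on [u]. *)
Lemma vertex_close H k s x u : symmetric H -> irreflexive H ->
  no_short_cycle n.+1 H -> uniq s -> (forall v, graph_ball n H u v -> v \in s) ->
  (k u + degree H u = d)%N ->
  (forall v, v != u -> graph_ball n H u v -> (k v + degree H v = d.+1)%N) ->
  (forall z, z <= 1 ->
     `|iint mu s (fun y => (y u <= z)%R%:R * weight H k y) x -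
       Phi z * iint mu s (weight H k) x| <= e * iint mu s (weight H k) x) /\
  `|iint mu s (fun y => Phi (1 - y u) * weight H k y) x -
     Ie * iint mu s (weight H k) x| <= e * iint mu s (weight H k) x.
Proof.
move=> sH iH nH us bs ku kv.
have gw : integrand (weight H k) by exact: integrand_weight.
have su : u \in s by apply: bs; exists [::].
pose w t := iint mu (rem u s) (weight H k) (upd x u t).
have bw : bmeas w by exact: bmeas_iint.
have Ez z : iint mu s (fun y => (y u <= z)%R%:R * weight H k y) x = pmass mu w z.
  apply: (iint_coord mu (phi := fun t : measurableTypeR R => (t <= z)%R%:R)) => //.
  exact: bmeas_le.
have E1 : iint mu s (weight H k) x = pmass mu w 1.
  by rewrite (iint_rem _ _ _ su)//= pmass1E.
have EP : iint mu s (fun y => Phi (1 - y u) * weight H k y) x =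
    \int[mu]_(t in `[0, 1]) (Phi (1 - t) * w t).
  apply: (iint_coord mu (phi := fun t : measurableTypeR R => Phi (1 - t))) => //.
  exact: bmeas_Phi1.
have bt : between mu d n (pmass mu w).
  have -> : pmass mu w = fun z => iint mu s (fun y => (y u <= z)%R%:R * (weight H k y * 1)) x.
    by apply/funext => z; rewrite -Ez; apply: eq_iint => y; rewrite mulr1.
  have g1 : integrand (fun _ : V -> R => 1 : R) by exact: integrand_cst.
  by apply: (tree_between mu_pos pPhi fixPhi x sH iH nH g1 us _ ku kv) => v /bs.
have h z : z <= 1 -> `|pmass mu w z - Phi z * pmass mu w 1| <= e * pmass mu w 1.
  by apply: (between_close _ _ bt) => // y; exact: pmass_ge0.
rewrite E1; split; first by move=> z z1; rewrite Ez h.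
by rewrite EP; exact: expectation_close.
Qed.

Definition cut a b H : rel V := fun v w =>
  H v w && ~~ ((v == a) && (w == b) || (v == b) && (w == a)).

Lemma cutC a b H : cut a b H = cut b a H.
Proof. by apply/funext => v; apply/funext => w; rewrite /cut orbC. Qed.

Lemma cut_sub a b H : subrel (cut a b H) H.
Proof. by move=> v w /andP[]. Qed.

Lemma cut_sym a b H : symmetric H -> symmetric (cut a b H).
Proof. by move=> sH v w; rewrite /cut sH [(w == a) && _]andbC [(w == b) && _]andbC orbC. Qed.

Lemma degree_cut a b H v : symmetric H -> irreflexive H -> H a b ->
  degree H v = (degree (cut a b H) v + ((v == a) + (v == b)))%N.
Proof.
move=> sH iH ab; rewrite /degree; have nab : b != a by exact: nbr_neq ab.
have [->|va] := eqVneq v a.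
  rewrite eq_sym (negbTE nab) addn0 addnC (cardsD1 b) inE ab; congr addn.
  by apply: eq_card => w; rewrite !inE /cut eqxx [a == b]eq_sym (negbTE nab)/= orbF andbC.
have [->|vb] := eqVneq v b.
  rewrite addnC (cardsD1 a) inE sH ab; congr addn.
  by apply: eq_card => w; rewrite !inE /cut eqxx (negbTE nab)/= andbC.
by rewrite !addn0; apply: eq_card => w; rewrite !inE /cut (negbTE va) (negbTE vb)/= andbT.
Qed.

(** Otherwise the edge [ab] would complete a short cycle. *)
Lemma cut_far a b H : symmetric H -> irreflexive H -> no_short_cycle n.+1 H ->
  H a b -> ~ graph_ball n (cut a b H) a b.
Proof.
move=> sH iH nH ab [p [pp lp sp]]; have nab : b != a by exact: nbr_neq ab.
case/shortenP: pp lp => p' pp' up' sub lp'.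
have sp' : (size p' <= size p)%N by apply: uniq_leq_size => //; case/andP: up'.
have := nH (a :: p'); rewrite /ucycle [cycle _ _]/= rcons_path.
rewrite (sub_path _ pp') /=; last exact: cut_sub.
rewrite lp' sH ab => /(_ up').
have s2 : (2 < (size p').+1)%N.
  case: (p') lp' pp' => [/= ba|c [|//]] /=; first by rewrite ba eqxx in nab.
  by move=> ->; rewrite /cut !eqxx/= andbF.
move=> /(_ s2); rewrite ltnS ltnNge => /negP; apply.
exact: leq_trans sp.
Qed.

Lemma no_short_cycle_sub m H H' : subrel H' H -> no_short_cycle m H -> no_short_cycle m H'.
Proof.
move=> HH nH c cc; apply: nH; case/andP: cc => cc uc; apply/andP; split => //.
by case: c cc {uc} => // c s; apply: sub_path.
Qed.

Definition field_mass H k : R := iint mu (enum V) (weight H k) (fun=> 0).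

Lemma weight_cut a b H k x : symmetric H -> H a b ->
  weight H k x = (x a <= 1 - x b)%R%:R * weight (cut a b H) k x.
Proof.
move=> sH ab; rewrite /gibbs_weight mulrA -natrM mulnb; congr (_%:R * _);
  congr nat_of_bool.
apply/idP/andP => [c|[xab c]].
  split; first by rewrite lerBrDr; move/forallP/(_ a)/forallP/(_ b)/implyP: c; apply.
  apply/forallP => v; apply/forallP => w; apply/implyP => /cut_sub vw.
  by move/forallP/(_ v)/forallP/(_ w)/implyP: c; apply.
apply/forallP => v; apply/forallP => w; apply/implyP => vw.
have [/orP[/andP[/eqP-> /eqP->]|/andP[/eqP-> /eqP->]]|h] :=
  boolP ((v == a) && (w == b) || (v == b) && (w == a)).
- by rewrite -lerBrDr.
- by rewrite addrC -lerBrDr.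
by move/forallP/(_ v)/forallP/(_ w)/implyP: c; apply; rewrite /cut vw.
Qed.

Lemma weight_field a b H k k' x : (forall v, k' v = k v + ((v == a) + (v == b)))%N ->
  weight H k' x = Phi (1 - x b) * (Phi (1 - x a) * weight H k x).
Proof.
move=> kk; suff E : \prod_v Phi (1 - x v) ^+ k' v =
    Phi (1 - x b) * (Phi (1 - x a) * \prod_v Phi (1 - x v) ^+ k v).
  by rewrite /gibbs_weight E; ring.
have single c : \prod_v Phi (1 - x v) ^+ (v == c) = Phi (1 - x c).
  by rewrite (bigD1 c)//= eqxx expr1 big1 ?mulr1// => v /negbTE ->; rewrite expr0.
rewrite -{1}(single a) -(single b) -!big_split/=; apply: eq_bigr => v _.
by rewrite kk !exprD; ring.
Qed.

(** Here [X] is the mass with the edge [ab] dropped, and the intermediate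
    quantity [Y] is the mass where, in addition, [b] carries the weight
    [Phi (1 - x b)]. Conditionally on the spin at [b], the edge imposes a threshold
    on the spin at [a], whose probability is nearly [Phi (1 - x b)]. This gives
    the first estimate. The other two replace the weights at [b] and then at
    [a] by their mean. *)
Lemma edge_close a b H k k' : symmetric H -> irreflexive H ->
  no_short_cycle n.+1 H -> H a b -> (forall v, k v + degree H v = d.+1)%N ->
  (forall v, k' v = k v + ((v == a) + (v == b)))%N ->
  let X := field_mass (cut a b H) k in
  exists Y, [/\ `|field_mass H k - Y| <= e * X, `|Y - Ie * X| <= e * X &
     `|field_mass (cut a b H) k' - Ie * Y| <= e * Y].
Proof.
move=> sH iH nH ab kH kk X; set H0 := cut a b H.
have nab : b != a by exact: nbr_neq ab.
have s0 : symmetric H0 by exact: cut_sym.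
have i0 : irreflexive H0 by move=> v; rewrite /H0 /cut iH.
have n0 : no_short_cycle n.+1 H0 by apply: no_short_cycle_sub nH; exact: cut_sub.
have fa : ~ graph_ball n H0 a b by exact: cut_far.
have fb : ~ graph_ball n H0 b a by rewrite /H0 cutC; apply: cut_far; rewrite 1?sH.
have dH v : degree H v = (degree H0 v + ((v == a) + (v == b)))%N by exact: degree_cut.
have kv v : v != a -> v != b -> (k v + degree H0 v = d.+1)%N.
  by move=> /negbTE va /negbTE vb; have := kH v; rewrite dH va vb !addn0.
have ka : (k a + degree H0 a = d)%N.
  by have := kH a; rewrite dH eqxx [a == b]eq_sym (negbTE nab) addn0 addn1 addnS => -[].
have kb : (k b + degree H0 b = d)%N.
  by have := kH b; rewrite dH eqxx (negbTE nab) add0n addn1 addnS => -[].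
have bP := bmeas_Phi1.
have gw : integrand (weight H0 k) by exact: integrand_weight.
pose s := enum V; pose r := rem b s.
have us : uniq s by exact: enum_uniq.
have sb : b \in s by rewrite mem_enum.
have br : b \notin r by rewrite mem_rem_uniq// inE eqxx.
pose B t := iint mu r (weight H0 k) (upd (fun=> 0) b t).
have bB : bmeas B by exact: bmeas_iint.
have XE : X = \int[mu]_(t in `[0, 1]) B t by rewrite /X /field_mass (iint_rem _ _ _ sb).
have ca t := vertex_close (upd (fun=> 0) b t) s0 i0 n0 (rem_uniq b us).
have {}ca t : (forall z, z <= 1 ->
     `|iint mu r (fun y => (y a <= z)%R%:R * weight H0 k y) (upd (fun=> 0) b t) -
       Phi z * B t| <= e * B t) /\
  `|iint mu r (fun y => Phi (1 - y a) * weight H0 k y) (upd (fun=> 0) b t) -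
     Ie * B t| <= e * B t.
  apply: ca => //.
    move=> v bv; rewrite mem_rem_uniq// inE mem_enum andbT.
    by apply/eqP => vb; apply: fa; rewrite -vb.
  move=> v va bv; apply: kv => //.
  by apply/eqP => vb; apply: fa; rewrite -vb.
have [_ cb] : (forall z, z <= 1 ->
     `|iint mu s (fun y => (y b <= z)%R%:R * weight H0 k y) (fun=> 0) -
       Phi z * X| <= e * X) /\
  `|iint mu s (fun y => Phi (1 - y b) * weight H0 k y) (fun=> 0) - Ie * X| <= e * X.
  apply: vertex_close => //; first by move=> v _; rewrite mem_enum.
  move=> v vb bv; apply: kv => //.
  by apply/eqP => va; apply: fb; rewrite -va.
exists (iint mu s (fun y => Phi (1 - y b) * weight H0 k y) (fun=> 0)).
have YE : iint mu s (fun y => Phi (1 - y b) * weight H0 k y) (fun=> 0) =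
    \int[mu]_(t in `[0, 1]) (Phi (1 - t) * B t).
  exact: (iint_coord mu (phi := fun t : measurableTypeR R => Phi (1 - t))).
split => //.
- have -> : field_mass H k = \int[mu]_(t in `[0, 1])
      iint mu r (fun y => (y a <= 1 - t)%R%:R * weight H0 k y) (upd (fun=> 0) b t).
    rewrite /field_mass (iint_rem _ _ _ sb)/=; last exact: integrand_weight.
    apply: eq_Rintegral => t _; apply: (eq_iint_at mu (u := b)) => // y.
    by rewrite upd_eq => yb; rewrite (weight_cut _ _ sH ab) yb.
  rewrite YE XE; apply: Rintegral_bmeas_close => //.
    have g2 : integrand (fun y => (y a + y b <= 1)%R%:R * weight H0 k y).
      by apply: integrandM => //; exact: integrand_le2.
    have -> : (fun t => iint mu r (fun y => (y a <= 1 - t)%R%:R * weight H0 k y)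
        (upd (fun=> 0) b t)) =
      (fun t => iint mu r (fun y => (y a + y b <= 1)%R%:R * weight H0 k y)
        (upd (fun=> 0) b t)).
      apply/funext => t; apply: (eq_iint_at mu (u := b)) => // y.
      by rewrite upd_eq lerBrDr => ->.
    exact: bmeas_iint.
  move=> t; rewrite /= in_itv/= => /andP[t0 t1]; apply: (ca t).1; lra.
- have -> : field_mass H0 k' = \int[mu]_(t in `[0, 1]) (Phi (1 - t) *
      iint mu r (fun y => Phi (1 - y a) * weight H0 k y) (upd (fun=> 0) b t)).
    rewrite /field_mass; under eq_iint do rewrite (weight_field _ _ kk).
    apply: (iint_coord mu (phi := fun t : measurableTypeR R => Phi (1 - t))) => //.
    by apply: integrandM => //;
      exact: (integrand_coord (phi := fun t : measurableTypeR R => Phi (1 - t))).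
  have ga : integrand (fun y => Phi (1 - y a) * weight H0 k y).
    by apply: integrandM => //;
      exact: (integrand_coord (phi := fun t : measurableTypeR R => Phi (1 - t))).
  rewrite YE -Rintegral_bmeasZ//; last exact: bmeasM.
  have Ie0 : 0 <= Ie.
    rewrite divr_ge0 ?pmass_ge0//; last by apply: bmeas_onem; have [] := pPhi.
    apply: Rintegral_ge0 => t _; rewrite mulr_ge0 ?exprn_ge0// (bmeas_ge0 t bP)//.
  apply: (@Rintegral_bmeas_close _ _ _ mu _ _ _ (fun=> Ie)) => //.
  + by apply: bmeasM => //; exact: bmeas_iint.
  + exact: bmeasM.
  + exact: bmeas_cst.
  move=> t _; rewrite mulrCA -mulrBr normrM ger0_norm; last exact: (bmeas_ge0 t bP).
  rewrite mulrCA; apply: ler_wpM2l; first exact: (bmeas_ge0 t bP).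
  by have [_] := ca t.
Qed.

Lemma edge_ratio_gt0 : 0 < Ie.
Proof.
have c0 := pmass_onem_gt0 d mu_pos pPhi ltr01.
rewrite divr_gt0//.
have -> : \int[mu]_(t in `[0, 1]) (Phi (1 - t) * Phi (1 - t) ^+ d) =
    pmass mu (fun t => Phi (1 - t) ^+ d.+1) 1.
  by rewrite pmass1E; apply: eq_Rintegral => t _; rewrite exprS.
exact: pmass_onem_gt0.
Qed.

(** Elementary algebra that turns the three estimates for an edge into a
    relative error linear in [del]. *)
Lemma ratio_bound (I X Y Z Z' del : R) : 0 < I -> 0 < Z' -> 0 <= del -> del <= 4^-1 ->
  `|Z - Y| <= del * I * X -> `|Y - I * X| <= del * I * X ->
  `|Z' - I * Y| <= del * I * Y ->
  [/\ 0 < Z, Z' <= I * Z * (1 + 10 * del) & I * Z <= Z' * (1 + 10 * del)].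
Proof.
move=> I0 Z'0 d0 d4; rewrite !ler_norml => /andP[h1 h2] /andP[h3 h4] /andP[h5 h6].
have Y0 : 0 < Y.
  have : 0 < (1 + del) * I * Y by lra.
  by rewrite pmulr_rgt0//; nra.
have X0 : 0 < X.
  have : 0 < (1 + del) * I * X by lra.
  by rewrite pmulr_rgt0//; nra.
pose T := I * X; have T0 : 0 < T by rewrite mulr_gt0.
have e1 : del * I * X = del * T by rewrite /T; ring.
rewrite e1 -/T in h1 h2 h3 h4.
(* Without error, [Z = T] and [Z' = S]. *)
pose S := I * T; have S0 : 0 < S by rewrite mulr_gt0.
have Zl : (1 - 2 * del) * T <= Z by lra.
have Zu : Z <= (1 + 2 * del) * T by lra.
have Z'l : (1 - del) ^+ 2 * S <= Z'.
  have a : (1 - del) * I * ((1 - del) * T) <= (1 - del) * I * Y.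
    by rewrite ler_wpM2l; [|rewrite mulr_ge0//; lra|lra].
  have -> : (1 - del) ^+ 2 * S = (1 - del) * I * ((1 - del) * T) by rewrite /S; ring.
  apply: (le_trans a); lra.
have Z'u : Z' <= (1 + del) ^+ 2 * S.
  have a : (1 + del) * I * Y <= (1 + del) * I * ((1 + del) * T).
    by rewrite ler_wpM2l; [|rewrite mulr_ge0//; lra|lra].
  have -> : (1 + del) ^+ 2 * S = (1 + del) * I * ((1 + del) * T) by rewrite /S; ring.
  apply: le_trans a; lra.
have IZl : (1 - 2 * del) * S <= I * Z.
  have -> : (1 - 2 * del) * S = I * ((1 - 2 * del) * T) by rewrite /S; ring.
  by rewrite ler_pM2l.
have IZu : I * Z <= (1 + 2 * del) * S.
  have -> : (1 + 2 * del) * S = I * ((1 + 2 * del) * T) by rewrite /S; ring.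
  by rewrite ler_pM2l.
have p1 : (1 + del) ^+ 2 <= (1 - 2 * del) * (1 + 10 * del) by nra.
have p2 : 1 + 2 * del <= (1 - del) ^+ 2 * (1 + 10 * del) by nra.
have k0 : 0 <= 1 + 10 * del by lra.
split.
- by apply: lt_le_trans Zl; rewrite mulr_gt0//; lra.
- apply: (le_trans Z'u); apply: le_trans (ler_wpM2r k0 IZl).
  by rewrite [leRHS]mulrAC ler_wpM2r// ltW.
- apply: (le_trans IZu); apply: le_trans (ler_wpM2r k0 Z'l).
  by rewrite [leRHS]mulrAC ler_wpM2r// ltW.
Qed.

Lemma ln_ratio_bound (I Z Z' c : R) : 0 < I -> 0 < Z -> 0 < Z' -> 0 <= c ->
  Z' <= I * Z * (1 + c) -> I * Z <= Z' * (1 + c) ->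
  `|ln Z' - ln Z - ln I| <= c.
Proof.
move=> I0 Z0 Z'0 c0 h1 h2.
have l : ln (1 + c) <= c by apply: le_ln1Dx; lra.
have c1 : 0 < 1 + c by lra.
have IZ : 0 < I * Z by rewrite mulr_gt0.
have a : ln Z' <= ln I + ln Z + ln (1 + c).
  by rewrite -!lnM ?posrE ?mulr_gt0// ler_ln ?posrE ?mulr_gt0.
have b : ln I + ln Z <= ln Z' + ln (1 + c).
  by rewrite -!lnM ?posrE ?mulr_gt0// ler_ln ?posrE ?mulr_gt0.
by rewrite ler_norml; lra.
Qed.

Definition vertex_term := \int[mu]_(t in `[0, 1]) (Phi (1 - t) ^+ d.+1).

Lemma vertex_term_gt0 : 0 < vertex_term.
Proof. by rewrite /vertex_term -pmass1E; exact: pmass_onem_gt0. Qed.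

(** Every vertex has total degree [d.+1], counting removed edges. *)
Definition cavity_mass H := field_mass H (fun v => (d.+1 - degree H v)%N).

Lemma cavity_mass_empty H : (forall v w, ~~ H v w) -> cavity_mass H = vertex_term ^+ #|V|.
Proof.
move=> H0; rewrite /cavity_mass /field_mass.
have deg0 v : degree H v = 0%N.
  by apply: eq_card0 => w; rewrite inE; exact/negbTE.
rewrite (eq_iint _ _ (g := fun x => \prod_(v <- enum V) Phi (1 - x v) ^+ d.+1)).
  rewrite (iint_prod mu (phi := fun t => Phi (1 - t) ^+ d.+1)) ?enum_uniq//.
    by rewrite -cardE.
  by apply: bmeasX; exact: bmeas_Phi1.
move=> x; rewrite /gibbs_weight.
have -> : compatible H x.
  by apply/forallP => v; apply/forallP => w; rewrite (negbTE (H0 v w)).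
rewrite mul1r big_enum/=; apply: eq_bigr => v _.
by rewrite deg0 subn0.
Qed.

(** Induction on the number of edges, counted through the sum of the degrees,
    which is twice that number. Positivity of the mass is carried along from
    the empty graph upwards, so that the logarithms make sense. *)
Lemma cavity_mass_close H : symmetric H -> irreflexive H -> no_short_cycle n.+1 H ->
  (forall v, (degree H v <= d.+1)%N) -> e <= 4^-1 * Ie ->
  0 < cavity_mass H /\
  `|ln (cavity_mass H) -
     (#|V|%:R * ln vertex_term - (\sum_v degree H v)%:R / 2 * ln Ie)|
   <= (\sum_v degree H v)%:R / 2 * (10 * (e / Ie)).
Proof.
have Ie0 := edge_ratio_gt0; have Iv0 := vertex_term_gt0.
move=> + + + + e4; have [m] := ubnP (\sum_v degree H v).
elim: m H => // m IH H; rewrite ltnS => Hm sH iH nH dH.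
have [/existsP[a /existsP[b ab]]|no] := boolP [exists a, exists b, H a b]; last first.
  have H0 v w : ~~ H v w.
    by apply: contraNN no => vw; apply/existsP; exists v; apply/existsP; exists w.
  have -> : (\sum_v degree H v = 0)%N.
    rewrite big1// => v _; apply: eq_card0 => w; rewrite inE; exact/negbTE.
  rewrite cavity_mass_empty// exprn_gt0//; split => //.
  by rewrite lnXn// !mul0r subr0 mulr_natl subrr normr0.
set H0 := cut a b H.
have dE v : degree H v = (degree H0 v + ((v == a) + (v == b)))%N by exact: degree_cut.
have sumE : (\sum_v degree H v = \sum_v degree H0 v + 2)%N.
  under eq_bigr do rewrite dE; rewrite big_split/= big_split/=; congr addn.
  rewrite (bigD1 a)//= eqxx big1 => [|v /negbTE -> //].
  by rewrite (bigD1 b)//= eqxx big1 => [|v /negbTE -> //].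
have [p IH0] : 0 < cavity_mass H0 /\ `|ln (cavity_mass H0) -
     (#|V|%:R * ln vertex_term - (\sum_v degree H0 v)%:R / 2 * ln Ie)|
   <= (\sum_v degree H0 v)%:R / 2 * (10 * (e / Ie)).
  apply: IH.
  - by apply: leq_trans Hm; rewrite sumE addn2.
  - exact: cut_sym.
  - by move=> v; rewrite /H0 /cut iH.
  - by apply: no_short_cycle_sub nH; exact: cut_sub.
  - by move=> v; apply: leq_trans (dH v); rewrite dE leq_addr.
have [Y [h1 h2 h3]] := edge_close sH iH nH ab
  (k := fun v => (d.+1 - degree H v)%N) (k' := fun v => (d.+1 - degree H0 v)%N)
  (fun v => subnK (dH v)) (fun v => ltac:(
     have := dH v; rewrite dE => dv;
     by rewrite -[in LHS](subnK dv) addnA addnAC addnK)).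
have eE : e = e / Ie * Ie by rewrite divfK// gt_eqF.
rewrite eE in h1 h2 h3.
have del0 : 0 <= e / Ie by rewrite divr_ge0// ltW.
have del4 : e / Ie <= 4^-1 by rewrite ler_pdivrMr.
have [Z0 r1 r2] := ratio_bound Ie0 p del0 del4 h1 h2 h3.
split => //.
have c0 : 0 <= 10 * (e / Ie) by rewrite mulr_ge0.
have := ln_ratio_bound Ie0 Z0 p c0 r1 r2.
rewrite -/(cavity_mass H) -/(cavity_mass H0) => q.
rewrite sumE natrD mulrDl divff// mulrDl mul1r mulrDl mul1r.
move: IH0 q; rewrite !ler_norml => /andP[? ?] /andP[? ?]; lra.
Qed.

Lemma regular_close H : symmetric H -> irreflexive H -> no_short_cycle n.+1 H ->
  (forall v, degree H v = d.+1) -> e <= 4^-1 * Ie ->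
  `|ln (iint mu (enum V) (fun x => (compatible H x)%:R) (fun=> 0)) -
     #|V|%:R * (ln vertex_term - d.+1%:R / 2 * ln Ie)|
   <= #|V|%:R * (d.+1%:R / 2 * (10 * (e / Ie))).
Proof.
move=> sH iH nH dH e4.
have [|_] := cavity_mass_close sH iH nH _ e4; first by move=> v; rewrite dH.
have -> : (\sum_v degree H v = #|V| * d.+1)%N.
  by under eq_bigr do rewrite dH; rewrite sum_nat_const.
have -> : cavity_mass H = iint mu (enum V) (fun x => (compatible H x)%:R) (fun=> 0).
  apply: eq_iint => x; rewrite /gibbs_weight big1 ?mulr1// => v _.
  by rewrite dH subnn expr0.
by rewrite natrM mulrBr !mulrA.
Qed.

End edge_removal.

(** * The activity measure *)

Section activity_measure.
Context {R : realType} (lambda : R).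
Local Notation leb := (@lebesgue_measure R).
Local Notation act := (activity lambda).

Lemma powR_bounds (x : R) : 0 < lambda -> 0 <= x <= 1 ->
  expR (- `|ln lambda|) <= lambda `^ x.
Proof.
move=> l0 /andP[x0 x1]; rewrite /powR gt_eqF// ler_expR.
have := ler_norm (- ln lambda); rewrite normrN => h.
have h' : 0 <= `|ln lambda| by [].
have [l|l] := leP 0 (ln lambda).
  by apply: (@le_trans _ _ 0); [rewrite oppr_le0|exact: mulr_ge0].
rewrite ltr0_norm// opprK; nra.
Qed.

Lemma powR_le (x : R) : 0 <= x <= 1 -> lambda `^ x <= expR `|ln lambda|.
Proof.
move=> /andP[x0 x1]; rewrite /powR; case: ifP => _.
  by apply: (@le_trans _ _ 1); [rewrite lern1 leq_b1|rewrite -expR0 ler_expR].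
rewrite ler_expR; apply: (le_trans (ler_norm _)); rewrite normrM ler_piMl//.
by rewrite ger0_norm.
Qed.

Lemma activity_finite : fin_num_fun act.
Proof.
move=> U mU; have mI : measurable (U `&` `[0%R, 1%R]) by exact: measurableI.
rewrite ge0_fin_numE//; rewrite /activity.
apply: (@le_lt_trans _ _ (\int[leb]_(x in U `&` `[0%R, 1%R]) (expR `|ln lambda|)%:E)%E).
  apply: ge0_le_integral => //.
  - by move=> x _; rewrite lee_fin powR_ge0.
  - by apply/measurable_EFinP/measurable_funTS; exact: measurable_powRr.
  - by move=> x [_]; rewrite /= in_itv/= => x01; rewrite lee_fin powR_le.
rewrite integral_cst//; apply: lte_mul_pinfty => //.
apply: (@le_lt_trans _ _ (leb `[0%R, 1%R])).
    by apply: le_measure; rewrite ?inE//; exact: subIsetr.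
by rewrite lebesgue_measure_itv/= lte01 oppr0 adde0 ltry.
Qed.

HB.instance Definition _ := Measure_isFinite.Build _ _ _ act activity_finite.

Lemma activity_indic (E : set R) : measurable E ->
  (\int[act]_x (\1_E x)%:E =
   \int[leb]_(x in `[0%R, 1%R]) ((lambda `^ x)%:E * (\1_E x)%:E))%E.
Proof.
move=> mE; rewrite integral_indic// setIT /= /activity setIC integral_mkcondr.
apply: eq_integral => x _; rewrite patchE indicE.
by case: ifPn => _; rewrite ?mule1 ?mule0.
Qed.

Import HBNNSimple.

Lemma activity_nnsfun (f : {nnsfun measurableTypeR R >-> R}) :
  (\int[act]_x (f x)%:E =
   \int[leb]_(x in `[0%R, 1%R]) ((lambda `^ x)%:E * (f x)%:E))%E.
Proof.
under [LHS]eq_integral do rewrite fimfunE -fsumEFin//.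
rewrite [LHS]ge0_integral_fsum//; last 2 first.
  - by move=> r; exact/measurable_EFinP/measurableT_comp.
  - by move=> n x _; rewrite EFinM nnfun_muleindic_ge0.
under [RHS]eq_integral.
  move=> x xD; rewrite fimfunE -fsumEFin// ge0_mule_fsumr; last first.
    by move=> r; rewrite EFinM nnfun_muleindic_ge0.
  over.
rewrite [RHS]ge0_integral_fsum//; last 2 first.
  - move=> r; apply: emeasurable_funM.
      by apply/measurable_EFinP/measurable_funTS; exact: measurable_powRr.
    by apply/measurable_EFinP; do 2 apply/measurableT_comp => //.
  - move=> n x _; rewrite EFinM mule_ge0//; last by rewrite nnfun_muleindic_ge0.
    by rewrite lee_fin powR_ge0.
apply: eq_fsbigr => r _.
have mfr : measurable (f @^-1` [set r]) by exact: measurable_sfunP.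
rewrite integralZl_indic_nnsfun//= activity_indic//.
have [r0|r0] := leP 0 r.
  rewrite -ge0_integralZl//.
  - by apply: eq_integral => x _; rewrite EFinM muleCA.
  - apply: emeasurable_funM.
      by apply/measurable_EFinP/measurable_funTS; exact: measurable_powRr.
    by apply/measurable_EFinP/measurable_funTS; exact: measurable_indic.
  - by move=> x _; rewrite mule_ge0 ?lee_fin ?powR_ge0.
rewrite preimage_nnfun0//.
rewrite !integral0_eq ?mule0// => x _; rewrite indicE in_set0 ?mulr0 mule0//.
Qed.

(** Integration against the activity measure is integration of the density,
    first for indicators, then by linearity and monotone convergence. *)
Lemma integral_activity (f : measurableTypeR R -> \bar R) : measurable_fun setT f ->
  (forall x, 0 <= f x)%E ->
  (\int[act]_x f x = \int[leb]_(x in `[0%R, 1%R]) ((lambda `^ x)%:E * f x))%E.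
Proof.
move=> mf f0; pose f_ := nnsfun_approx measurableT mf.
transitivity (lim (\int[act]_x (f_ n x)%:E @[n --> \oo])%E).
  rewrite -monotone_convergence//=.
  - apply: eq_integral => ? /[!inE] xD; apply/esym/cvg_lim => //=.
    exact: cvg_nnsfun_approx.
  - by move=> n; exact/measurable_EFinP/measurable_funTS.
  - by move=> n ? _; rewrite lee_fin.
  - by move=> ? _ ? ? mn; rewrite lee_fin; exact/lefP/nd_nnsfun_approx.
transitivity (lim (\int[leb]_(x in `[0%R, 1%R]) ((lambda `^ x)%:E * (f_ n x)%:E)
    @[n --> \oo])%E).
  by apply: congr_lim; apply/funext => n /=; exact: activity_nnsfun.
rewrite -monotone_convergence//=.
- apply: eq_integral => x /[!inE] xD; apply/cvg_lim => //.
  by apply: cvgeZl => //; exact: cvg_nnsfun_approx.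
- move=> n; apply: emeasurable_funM.
    by apply/measurable_EFinP/measurable_funTS; exact: measurable_powRr.
  exact/measurable_EFinP/measurable_funTS.
- by move=> n x _; rewrite mule_ge0 ?lee_fin ?powR_ge0.
- move=> x _ m n mn; apply: lee_pmul => //; rewrite ?lee_fin ?powR_ge0//.
  exact/lefP/nd_nnsfun_approx.
Qed.

Lemma Rintegral_activity (D : set R) (f : R -> R) : measurable D -> bmeas f ->
  \int[act]_(x in D) f x = \int[leb]_(x in `[0, 1] `&` D) (lambda `^ x * f x).
Proof.
move=> mD bf; rewrite Rintegral_mkcond Rintegral_mkcondr /Rintegral; congr fine.
have bfD : bmeas (f \_ D).
  rewrite (_ : f \_ D = fun x => f x * \1_D x).
    apply: bmeasM => //; split; first exact: measurable_indic.
    by exists 1 => x; rewrite indicE ler0n lern1 leq_b1.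
  apply/funext => x; rewrite patchE indicE.
  by case: ifP; rewrite ?mulr1 ?mulr0.
rewrite integral_activity.
- apply: eq_integral => x _; rewrite !patchE -EFinM.
  by case: ifP; rewrite ?mulr0.
- by apply/measurable_EFinP; exact: bfD.1.
- by move=> x; rewrite lee_fin; exact: bmeas_ge0.
Qed.

Lemma activity_pmass_gt0 z : 0 < lambda -> 0 < z -> 0 < pmass act (fun=> 1) z.
Proof.
move=> l0 z0; pose y := Num.min z 1.
have y0 : 0 < y by rewrite lt_min z0 ltr01.
have yz : y <= z by rewrite ge_min lexx.
have y1 : y <= 1 by rewrite ge_min lexx orbT.
have b1 : bmeas (fun _ : measurableTypeR R => 1 : R) by exact: bmeas_cst.
apply: lt_le_trans (pmass_nondecreasing _ b1 yz).
rewrite /pmass Rintegral_bool// Rintegral_activity//; last first.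
  apply: measurableI => //.
  have -> : [set x : measurableTypeR R | x <= y] = `]-oo, y]%classic; last by [].
  by apply/seteqP; split => x /=; rewrite in_itv.
have -> : `[0, 1] `&` (`[0, 1] `&` [set x | x <= y]) = `[0, y]%classic.
  apply/seteqP; split => x /=; rewrite !in_itv/=.
    by move=> [_ [/andP[-> _] ->]].
  by move=> /andP[x0 xy]; rewrite x0 xy (le_trans xy y1).
have E : \int[leb]_(x in `[0, y]) (expR (- `|ln lambda|) : R) = expR (- `|ln lambda|) * y.
  by rewrite Rintegral_cst//= lebesgue_measure_itv/= lte_fin y0/= oppr0 addr0.
apply: (@lt_le_trans _ _ (expR (- `|ln lambda|) * y)).
  by rewrite mulr_gt0 ?expR_gt0.
rewrite -E; apply: le_Rintegral => //.
- apply: measurable_bounded_integrable => //.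
  + by rewrite /= lebesgue_measure_itv/= lte_fin y0 oppr0 adde0 ltry.
  + by exists (expR (- `|ln lambda|)); split => // r rr x _ /=;
    rewrite ger0_norm ?expR_ge0// ltW.
- apply: measurable_bounded_integrable => //.
  + by rewrite /= lebesgue_measure_itv/= lte_fin y0 oppr0 adde0 ltry.
  + apply: measurable_funM => //; apply: measurable_funTS; exact: measurable_powRr.
  + exists (expR `|ln lambda|); split => // r rr x /=; rewrite in_itv/= => /andP[x0 xy].
    rewrite mulr1 ger0_norm ?powR_ge0// (le_trans _ (ltW rr))// powR_le// x0.
    exact: le_trans y1.
move=> x; rewrite /= in_itv/= => /andP[x0 xy]; rewrite mulr1 powR_bounds// x0.
exact: le_trans y1.
Qed.

(** The activity measure does not charge the complement of the unit interval. *)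
Lemma integral_activity01 (f : R -> R) : bmeas f ->
  (\int[act]_x (f x)%:E = (\int[act]_(x in `[0%R, 1%R]) f x)%:E)%E.
Proof.
move=> bf; rewrite /Rintegral fineK; last first.
  by apply: integrable_fin_num => //; exact: (bmeas_integrable act).
have m01 : measurable (`[0%R, 1%R]%classic : set R) by [].
rewrite -(setUv `[0%R, 1%R]%classic) ge0_integral_setU//=.
- rewrite [X in (_ + X)%E](_ : _ = 0%E) ?adde0//.
  apply: null_set_integral => //.
  + exact: measurableC.
  + by apply/measurable_EFinP; apply: measurable_funTS; exact: bf.1.
  + by rewrite /= /activity setICl integral_set0.
- exact: measurableC.
- by apply/measurable_EFinP; apply: measurable_funTS; exact: bf.1.
- by move=> x _; rewrite lee_fin; exact: bmeas_ge0.
- by apply/disj_setPCl.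
Qed.

End activity_measure.

(** * The limit distribution function and the Bethe functional *)

Section limit_cdf.
Context {R : realType} (lambda : R) (d : nat) (F : R -> R).
Hypotheses (lambda0 : 0 < lambda) (limF : is_limit_cdf d lambda F).
Local Notation leb := (@lebesgue_measure R).
Local Notation act := (activity lambda).

Let mu_pos z : 0 < z -> 0 < pmass act (fun=> 1) z := activity_pmass_gt0 lambda0.

Lemma pmass_itv (mu : {finite_measure set (measurableTypeR R) -> \bar R})
    (phi : R -> R) (z : R) : 0 <= z <= 1 ->
  pmass mu phi z = \int[mu]_(t in `[0, z]) phi t.
Proof.
move=> /andP[z0 z1]; rewrite /pmass Rintegral_bool//; congr (Rintegral _ _ _).
apply/seteqP; split => x /=; rewrite !in_itv/=.
  by move=> [/andP[-> _] ->].
by move=> /andP[x0 xz]; rewrite x0 xz (le_trans xz z1).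
Qed.

(** The shift of the index by one occurs because leaves at 0 impose nothing on
    the vertices above them. *)
Lemma root_cdf_free n (z : R) : 0 <= z <= 1 ->
  root_cdf lambda (fun _ : n.+1.-tuple 'I_d => 0) z = cavity_iter act d n.+1 z.
Proof.
elim: n z => [|n IH] z z01; have /andP[z0 z1] := z01.
  rewrite [RHS]/= /cavity !pmass_itv ?lexx ?ler01//.
  rewrite /= (_ : \big[Num.max/0]_(i < d) 0 = 0 :> R); last first.
    by elim/big_ind: _ => // x y -> ->; rewrite maxxx.
  rewrite ltr01 subr0 (min_idPl z1).
  have one y : \int[act]_(t in `[0, y]) (1 ^+ d : R) = fine (act `[0, y]%classic).
    by rewrite Rintegral_cst// expr1n mul1r.
  by rewrite !one.
have E (y : R) : 0 <= y <= 1 ->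
    \int[act]_(t in `[0, y]) \prod_(i < d)
      root_cdf lambda (fun _ : n.+1.-tuple 'I_d => 0) (1 - t) =
    pmass act (fun t => cavity_iter act d n.+1 (1 - t) ^+ d) y.
  move=> y01; rewrite pmass_itv//; apply: eq_Rintegral => t.
  rewrite inE/= in_itv/= => /andP[t0 ty].
  rewrite prodr_const card_ord IH//.
  by have /andP[] := y01; lra.
by rewrite [LHS]/= !E// ?lexx ?ler01.
Qed.

(** The hypotheses on [F] bear on the unit interval only; the extension by
    constants makes monotonicity, and hence measurability, global. *)
Definition clamped (z : R) : R := F (Num.max 0 (Num.min z 1)).

Lemma clampedE z : 0 <= z <= 1 -> clamped z = F z.
Proof. by move=> /andP[z0 z1]; rewrite /clamped (min_idPl z1) (max_idPr z0). Qed.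

Lemma clamped_mono : {homo clamped : x y / x <= y}.
Proof.
have [mF _ _ _ _] := limF; move=> x y xy; apply: mF.
- by rewrite in_itv/= le_max lexx/= ge_max ler01 ge_min lexx orbT.
- by rewrite in_itv/= le_max lexx/= ge_max ler01 ge_min lexx orbT.
by rewrite ge_max le_max lexx/= le_max le_min !ge_min xy lexx !orbT.
Qed.

(** The leaf condition 0 is one of those over which the convergence is uniform. *)
Lemma cavity_iter_cvg e : 0 < e -> exists N, forall n, (N <= n)%N ->
  forall z, `|cavity_iter act d n z - clamped z| <= e.
Proof.
move=> e0; have [_ F0 _ _ cF] := limF.
have ne : nbhs 0%E [set y | (y < e%:E)%E].
  by apply: open_nbhs_nbhs; split; [exact: open_ereal_lt_ereal|rewrite /= lte_fin].
have [N _ hN] := cF _ ne.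
exists N.+1 => -[//|n]; rewrite ltnS => Nn.
have h (z : R) : 0 <= z <= 1 -> `|cavity_iter act d n.+1 z - clamped z| <= e.
  move=> z01; rewrite clampedE// -root_cdf_free// -lee_fin.
  apply: (le_trans _ (ltW (hN n Nn))); apply: ereal_sup_ubound.
  exists (fun=> 0, z) => //=; split; last by rewrite in_itv.
  by move=> l; rewrite in_itv/= lexx ler01.
move=> z; have [z0|z0] := ltP z 0.
  have -> : cavity_iter act d n.+1 z = 0.
    rewrite /= /cavity (_ : pmass _ _ z = 0) ?mul0r// /pmass.
    transitivity (\int[act]_(t in `[0, 1]) (0 : R));
      last by rewrite Rintegral_cst// mul0r.
    apply: eq_Rintegral => t; rewrite inE/= in_itv/= => /andP[t0 _].
    by rewrite leNgt (lt_le_trans z0 t0) mul0r.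
  rewrite /clamped (min_idPl (ltW (lt_trans z0 ltr01))) (max_idPl (ltW z0)) F0 subrr normr0.
  exact: ltW.
have [z1|z1] := leP z 1; first by rewrite h// z0.
have -> : cavity_iter act d n.+1 z = cavity_iter act d n.+1 1.
  by rewrite /= /cavity [in LHS]pmass_ge1// ltW.
have -> : clamped z = clamped 1.
  by rewrite /clamped (min_idPr (ltW z1)) minxx.
by rewrite h// ler01 lexx.
Qed.

Let Phi := clamped.

Lemma clamped_cdf_like : cdf_like Phi.
Proof. exact: (cdf_like_limit mu_pos cavity_iter_cvg clamped_mono). Qed.

Lemma clamped_fixpoint : cavity act d Phi = Phi.
Proof. exact: (cavity_limit mu_pos cavity_iter_cvg clamped_mono). Qed.

Let C := pmass act (fun t => Phi (1 - t) ^+ d) 1.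
Let C0 : 0 < C. Proof. exact: (pmass_onem_gt0 d mu_pos clamped_cdf_like). Qed.

Lemma powR_cont (x : R) : {for x, continuous (fun t : R => lambda `^ t)}.
Proof.
rewrite /powR gt_eqF//.
apply: continuous_comp; last exact: continuous_expR.
by apply: continuousM; [exact: cvg_id|exact: cvg_cst].
Qed.

(** On the open interval the fixed point equation presents [F] as the integral
    of a continuous function; continuity comes from the derivability of [F]. *)
Lemma derive_limit (x : R) : 0 < x < 1 ->
  derive1 F x = C^-1 * (lambda `^ x * Phi (1 - x) ^+ d).
Proof.
move=> /andP[x0 x1]; have [_ _ dF _ _] := limF.
pose f (t : R) := lambda `^ t * Phi (1 - t) ^+ d.
pose G (z : R) := \int[leb]_(t in `[0, z]) f t.
have [bP _ P1 _ _] := clamped_cdf_like.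
have bo := bmeas_onem d bP.
have FG (z : R) : 0 < z < 1 -> F z = (C^-1 \*: G) z.
  move=> /andP[z0 z1]; have z01 : 0 <= z <= 1 by rewrite !ltW.
  rewrite -clampedE// -/Phi -clamped_fixpoint /cavity -/C mulrC /=.
  congr (_ * _); rewrite pmass_itv// Rintegral_activity//.
  congr (Rintegral _ _ _); apply/seteqP; split => t /=; rewrite !in_itv/=.
    by move=> [].
  by move=> /andP[t0 tz]; rewrite t0 tz (le_trans tz (ltW z1)).
have nearF : \near x, F x = (C^-1 \*: G) x.
  near=> y; apply: FG; apply/andP; split.
    by near: y; exact: lt_nbhsr.
  by near: y; exact: lt_nbhsl.
have cPhi : {for (1 - x), continuous Phi}.
  have x1' : 0 < 1 - x < 1 by lra.
  have cF : {for (1 - x), continuous F}.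
    apply: differentiable_continuous; apply/derivable1_diffP; apply: dF.
    by rewrite in_itv/=.
  rewrite /prop_for /continuous_at in cF *.
  rewrite /Phi clampedE; last by case/andP: x1' => *; rewrite !ltW.
  apply: cvg_trans cF; apply: near_eq_cvg; near=> y.
  rewrite clampedE//; apply/andP; split; apply: ltW.
    by near: y; apply: lt_nbhsr; case/andP: x1'.
  by near: y; apply: lt_nbhsl; case/andP: x1'.
have cf : {for x, continuous f}.
  apply: continuousM; first exact: powR_cont.
  have c1 : {for x, continuous (fun t : R => Phi (1 - t))}.
    apply: (@continuous_comp _ _ _ (fun t : R => 1 - t) Phi) => //.
    by apply: continuousB; [exact: cvg_cst|exact: cvg_id].
  have := @continuous_comp _ _ _ (fun t : R => Phi (1 - t)) (fun y => y ^+ d) x c1.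
  by apply; exact: exprn_continuous.
have intf : leb.-integrable `[0, 1] (EFin \o f).
  apply: measurable_bounded_integrable => //.
  - by rewrite /= lebesgue_measure_itv/= lte_fin ltr01 oppr0 adde0 ltry.
  - apply: measurable_funTS; apply: measurable_funM; last exact: bo.1.
    exact: measurable_powRr.
  exists (expR `|ln lambda|); split => // r rr t /=; rewrite in_itv/= => t01.
  rewrite ger0_norm ?mulr_ge0 ?powR_ge0 ?(bmeas_ge0 t bo)//.
  apply: (le_trans _ (ltW rr)); apply: (@le_trans _ _ (lambda `^ t * 1)).
    by rewrite ler_wpM2l ?powR_ge0// exprn_ile1 ?(bmeas_ge0 _ bP).
  by rewrite mulr1 powR_le.
have [dG G'] := continuous_FTC1_closed x1 intf x0 cf.
rewrite derive1E (near_eq_derive _ nearF) deriveZ; last exact: dG.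
by rewrite -derive1E G'.
Unshelve. all: by end_near. Qed.

Lemma vertex_termE :
  \int[leb]_(x in `[0, 1]) (lambda `^ x * F (1 - x) ^+ d.+1) = vertex_term act d Phi.
Proof.
have [bP _ _ _ _] := clamped_cdf_like.
rewrite /vertex_term Rintegral_activity//; last exact: (bmeas_onem d.+1 bP).
rewrite setIid; apply: eq_Rintegral => t; rewrite inE/= in_itv/= => t01.
by rewrite /Phi clampedE//; lra.
Qed.

(** The fixed point equation turns [F^`() x dx] into the density of the law
    [Phi] with respect to the activity measure. *)
Lemma edge_ratioE :
  \int[leb]_(x in `]0, 1[) (derive1 F x * F (1 - x)) = edge_ratio act d Phi.
Proof.
have [bP _ P1 _ _] := clamped_cdf_like.
have bo := bmeas_onem d bP.
have bP1 : bmeas (fun t : measurableTypeR R => Phi (1 - t)).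
  by apply: (bmeas_comp (f := Phi)) => //; exact: measurable_one_minus.
have bg : bmeas (fun t : measurableTypeR R => Phi (1 - t) * Phi (1 - t) ^+ d) by exact: bmeasM.
pose g (t : R) := C^-1 * (lambda `^ t * (Phi (1 - t) * Phi (1 - t) ^+ d)).
have intg : leb.-integrable `[0, 1]
    (EFin \o (fun t : R => lambda `^ t * (Phi (1 - t) * Phi (1 - t) ^+ d))).
  apply: measurable_bounded_integrable => //.
  - by rewrite /= lebesgue_measure_itv/= lte_fin ltr01 oppr0 adde0 ltry.
  - apply: measurable_funTS; apply: measurable_funM; last exact: bg.1.
    exact: measurable_powRr.
  exists (expR `|ln lambda|); split => // r rr t /=; rewrite in_itv/= => t01.
  rewrite ger0_norm ?mulr_ge0 ?powR_ge0 ?(bmeas_ge0 t bo) ?(bmeas_ge0 t bP1)//.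
  apply: (le_trans _ (ltW rr)); apply: (@le_trans _ _ (lambda `^ t * 1)).
    rewrite ler_wpM2l ?powR_ge0// -exprS exprn_ile1 ?(bmeas_ge0 _ bP)//.
  by rewrite mulr1 powR_le.
transitivity (\int[leb]_(x in `]0, 1[) g x).
  apply: eq_Rintegral => t; rewrite inE/= in_itv/= => t01.
  rewrite derive_limit// /g -clampedE; last by case/andP: t01; lra.
  by rewrite /Phi; ring.
have intg' : leb.-integrable `[0, 1] (EFin \o g).
  rewrite (_ : EFin \o g = fun t =>
      (C^-1%:E * (lambda `^ t * (Phi (1 - t) * Phi (1 - t) ^+ d))%:E)%E)//.
  exact: integrableZl.
rewrite Rintegral_itv_obnd_cbnd; last first.
  by apply: integrableS intg' => //; apply: subset_itv; rewrite bnd_simp.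
rewrite Rintegral_itv_bndo_bndc; last first.
  by apply: integrableS intg' => //; apply: subset_itv; rewrite bnd_simp.
rewrite /edge_ratio -/C mulrC RintegralZl//; congr (_ * _).
by rewrite Rintegral_activity// setIid.
Qed.

Lemma bethe_limitE : bethe_limit d.+1 lambda F =
  ln (vertex_term act d Phi) - d.+1%:R / 2 * ln (edge_ratio act d Phi).
Proof. by rewrite /bethe_limit vertex_termE edge_ratioE. Qed.

End limit_cdf.

(** * The partition function as an iterated integral *)

Section partition_function.
Context {R : realType} (lambda : R).
Local Notation act := (activity lambda).

Fixpoint fill {V : eqType} (x : V -> R) (s : seq V) (y : seq R) : V -> R :=
  match s, y with
  | v :: s', t :: y' => fill (upd x v t) s' y'
  | _, _ => x
  end.

Lemma fill_notin (V : eqType) (x : V -> R) s y v : v \notin s -> fill x s y v = x v.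
Proof.
elim: s x y => [//|w s IH] x [//|t y] /=; rewrite inE negb_or => /andP[vw vs].
by rewrite IH// upd_neq.
Qed.

Lemma fillE (V : eqType) (x : V -> R) s y v : uniq s -> size s = size y -> v \in s ->
  fill x s y v = nth 0 y (index v s).
Proof.
elim: s x y => [//|w s IH] x [//|t y] /= /andP[ws us] [sy]; rewrite inE.
have [->|vw] := eqVneq v w; first by rewrite fill_notin// upd_eq.
by move=> /= vs; exact: IH.
Qed.

(** Both sides integrate the coordinates in the same order. *)
Lemma power_measure_iint (V : eqType) n (s : seq V) (b : (V -> R) -> bool)
    (x : V -> R) (A : set (n.-tuple (measurableTypeR R))) :
  size s = n -> integrand (fun x => (b x)%:R : R) ->
  (forall y : n.-tuple (measurableTypeR R), A y <-> b (fill x s y)) ->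
  power_measure act A = (iint act s (fun x => (b x)%:R) x)%:E.
Proof.
move=> + gb; elim: n s x A => [|n IH] s x A; case: s => [|v s] //=.
  move=> _ h; rewrite diracE; congr (_%:R%:E); congr nat_of_bool.
  by apply/idP/idP => [/set_mem/h//|bx]; apply/mem_set/h.
move=> [sn] h; rewrite -integral_activity01; last exact: bmeas_iint.
suff -> : (fun t => power_measure act
      [set y : n.-tuple (measurableTypeR R) | A [tuple of t :: y]]) =
    (fun t => (iint act s (fun x => (b x)%:R) (upd x v t))%:E) by [].
by apply/funext => t; apply: IH => // y; exact: h.
Qed.

Lemma eq_iint01 (V : eqType) (s : seq V) f g (x : V -> R) :
  (forall y, (forall v, v \in s -> 0 <= y v <= 1) ->
     (forall v, v \notin s -> y v = x v) -> f y = g y) ->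
  iint act s f x = iint act s g x.
Proof.
elim: s x => [|v s IH] x h; first by apply: h => // v _.
rewrite /=; apply: eq_Rintegral => t; rewrite inE/= in_itv/= => t01.
apply: IH => y y01 yx; apply: h => w; rewrite inE; last first.
  by rewrite negb_or => /andP[wv ws]; rewrite yx// upd_neq.
have [ws _|ws] := boolP (w \in s); first exact: y01.
by rewrite orbF => /eqP wv; rewrite yx// wv upd_eq.
Qed.

(** The coordinate of rank [enum_rank u] is the one integrated for [u], because
    the vertices are listed in the order of [enum]. *)
Lemma partition_functionE (V : finType) (e : rel V) :
  partition_function e lambda =
  iint act (enum V) (fun x => (compatible e x)%:R) (fun=> 0).
Proof.
pose b (x : V -> R) := [forall v, 0 <= x v] && compatible e x.
have gb : integrand (fun x => (b x)%:R : R).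
  rewrite (_ : (fun _ => _) = fun x : V -> R =>
     \prod_v (0 <= x v)%R%:R * (compatible e x)%:R : R).
    apply: integrandM; last exact: integrand_compatible.
    apply: integrand_prod => v;
      apply: (integrand_coord (phi := fun t : R => (0 <= t)%R%:R)).
    by apply: bmeas_bool; exact: measurable_fun_ler.
  by apply/funext => x; rewrite -natr_forall -natrM mulnb.
rewrite /partition_function (power_measure_iint (s := enum V) (b := b) (x := fun=> 0))//.
- rewrite [LHS]/=; apply: eq_iint01 => y y01 _; rewrite /b.
  have -> // : [forall v, 0 <= y v].
  by apply/forallP => v; have /andP[] := y01 v (mem_enum _ _).
- by rewrite -cardE.
move=> y; have E v : fill (fun=> 0) (enum V) y v = tnth y (enum_rank v).
  rewrite fillE ?enum_uniq ?mem_enum ?size_tuple -?cardE// (tnth_nth 0); congr nth.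
  by rewrite -{1}(nth_enum_rank v v) index_uniq ?enum_uniq// -cardE.
rewrite /hardcore_polytope /b; split.
  move=> [y0 y1]; apply/andP; split.
    by apply/forallP => v; rewrite E.
  apply/forallP => v; apply/forallP => w; apply/implyP => vw.
  by rewrite !E y1.
move=> /andP[/forallP y0 /forallP y1]; split.
  by move=> v; rewrite -E y0.
by move=> v w vw; rewrite -!E; move: (y1 v) => /forallP/(_ w)/implyP; exact.
Qed.

End partition_function.

(** * The limit along graphs of growing girth *)

Lemma girth_no_short_cycle (R : realType) (V : finType) (e : rel V) (m : nat) :
  (m%:R%:E < (girth e : \bar R))%E -> no_short_cycle m e.
Proof.
move=> mg c cc c2; rewrite -(ltr_nat R) -lte_fin; apply: (lt_le_trans mg).
by apply: ereal_inf_lbound; exists c.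
Qed.

Theorem theorem3p5 (R : realType) (lambda : R) (Delta : nat) (F : R -> R)
    (V : nat -> finType) (e : forall n, rel (V n)) :
  0 < lambda ->
  (1 <= Delta)%N ->
  is_limit_cdf Delta.-1 lambda F ->
  (forall n, (0 < #|V n|)%N) ->
  (forall n, symmetric (e n)) ->
  (forall n, irreflexive (e n)) ->
  (forall n (u : V n), #|[set v | e n u v]%SET| = Delta) ->
  girth (e n) @[n --> \oo] --> (+oo%E : \bar R) ->
  ln (partition_function (e n) lambda) / #|V n|%:R @[n --> \oo]
    --> bethe_limit Delta lambda F.
Proof.
move=> l0; case: Delta => [//|d] _ limF V0 sE iE dE gE.
rewrite bethe_limitE//.
set Phi := clamped F; set Iv := vertex_term _ _ _; set Ie := edge_ratio _ _ _.
have mu_pos z : 0 < z -> 0 < pmass (activity lambda) (fun=> 1) z.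
  exact: activity_pmass_gt0.
have pPhi : cdf_like Phi := clamped_cdf_like l0 limF.
have fPhi : cavity (activity lambda) d Phi = Phi := clamped_fixpoint l0 limF.
have Ie0 : 0 < Ie := edge_ratio_gt0 d mu_pos pPhi.
apply/cvgrPdist_le => eps eps0.
pose kap : R := d.+1%:R / 2 * 10 / Ie.
have kap0 : 0 < kap by rewrite divr_gt0// !mulr_gt0.
(* [kap * c] bounds the error per vertex when the iterates are within [c] of [Phi]. *)
pose c := Num.min (4^-1 * Ie) (eps / kap).
have c0 : 0 < c by rewrite lt_min mulr_gt0//= divr_gt0.
have [m hm] := cavity_iter_cvg limF c0.
have ng : nbhs (+oo%E : \bar R) [set y | (m.+1%:R%:E < y)%E].
  by apply: open_nbhs_nbhs; split; [exact: open_ereal_gt_ereal|rewrite /= ltry].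
have [N _ hN] := gE _ ng.
exists N => // n /hN /girth_no_short_cycle nc.
have N0 : 0 < #|V n|%:R :> R by rewrite ltr0n.
have c4 : c <= 4^-1 * Ie by rewrite ge_min lexx.
have := regular_close mu_pos pPhi fPhi (ltW c0) (hm m (leqnn _)) (hm m.+1 (leqnSn _))
  (sE n) (iE n) nc (dE n) c4.
rewrite -partition_functionE -/Iv -/Ie => h.
rewrite distrC -(ler_pM2l N0) -{1}(gtr0_norm N0) -normrM mulrBr mulrCA divff ?gt_eqF// mulr1.
apply: (le_trans h); rewrite ler_pM2l//.
have -> : d.+1%:R / 2 * (10 * (c / Ie)) = kap * c by rewrite /kap; ring.
by rewrite -ler_pdivlMl// mulrC ge_min lexx orbT.
Qed.
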